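(* Let $A$ be a bounded linear operator on $H^2$. For a nonconstant inner function $\alpha$ put $A_\alpha=P_\alpha A|_{K^2_\alpha}\colon K^2_\alpha\to K^2_\alpha$. The following are equivalent: (1) $A=T_\varphi$ for some $\varphi\in L^\infty$; (2) $C_\alpha A_\alpha C_\alpha=A_\alpha^*$ for every nonconstant inner function $\alpha$; (3) $C_\alpha A_\alpha C_\alpha=A_\alpha^*$ for every $\alpha=z^n$, $n\in\mathbb{N}$.
   Context: $L^2=L^2(\mathbb{T},m)$, $L^\infty=L^\infty(\mathbb{T},m)$ with $m$ normalized Lebesgue measure on the unit circle; $P\colon L^2\to H^2$ is the orthogonal projection and the Toeplitz operator with symbol $\varphi\in L^\infty$ is $T_\varphi f=P(\varphi f)$, $f\in H^2$. For a nonconstant inner $\alpha$, $K^2_\alpha=H^2\ominus\alpha H^2$, $P_\alpha$ is the orthogonal projection onto $K^2_\alpha$, and $C_\alpha f(z)=\alpha(z)\overline{zf(z)}$ ($|z|=1$) is a conjugation on $K^2_\alpha$. *)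

(* Defs.v *)
(* Functions on the unit circle T are represented
   by functions t |-> f(e^{2 pi i t}) on the parameter interval [0,1]; the
   normalized Lebesgue measure m on T becomes Lebesgue measure on [0,1].
   Complex numbers are R[i] (mathcomp real_closed complex). Elements of
   L^2, H^2, ... are represented by functions, equal when equal a.e. *)
From HB Require Import structures.
From mathcomp Require Import all_boot all_order all_algebra.
From mathcomp Require Import all_classical all_reals all_analysis.
From mathcomp Require Import complex.

Set Implicit Arguments.
Unset Strict Implicit.
Unset Printing Implicit Defensive.

Import Order.TTheory GRing.Theory Num.Theory.
Local Open Scope classical_set_scope.
Local Open Scope ring_scope.
Local Open Scope complex_scope.

Section Hardy.
Variable R : realType.

(* the parameter interval of the circle, t |-> e^{2 pi i t} *)
Definition Tpar : set R := `[0%R, 1%R].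

(* squared modulus |z|^2 *)
Definition sqmod (z : R[i]) : R := complex.Re z ^+ 2 + complex.Im z ^+ 2.

(* "P holds m-almost everywhere on T" *)
Definition ae_T (P : R -> Prop) : Prop :=
  {ae (@lebesgue_measure R), forall t, Tpar t -> P t}.

(* equality a.e. (equality in L^2 / L^infty) *)
Definition ae_eqT (f g : R -> R[i]) : Prop := ae_T (fun t => f t = g t).

Definition cmeasurable (f : R -> R[i]) : Prop :=
  measurable_fun Tpar (fun t => complex.Re (f t)) /\
  measurable_fun Tpar (fun t => complex.Im (f t)).

(* L^2(T, m) *)
Definition L2 (f : R -> R[i]) : Prop :=
  cmeasurable f /\
  (\int[@lebesgue_measure R]_(t in Tpar) (sqmod (f t))%:E < +oo)%E.

(* L^infty(T, m) *)
Definition Linf (f : R -> R[i]) : Prop :=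
  cmeasurable f /\ exists M : R, ae_T (fun t => sqmod (f t) <= M).

(* integral over T w.r.t. m of a complex function *)
Definition cintegral (f : R -> R[i]) : R[i] :=
  Complex (Rintegral (@lebesgue_measure R) Tpar (fun t => complex.Re (f t)))
          (Rintegral (@lebesgue_measure R) Tpar (fun t => complex.Im (f t))).

(* inner product of L^2: <f, g> = \int f conj(g) dm *)
Definition inner (f g : R -> R[i]) : R[i] :=
  cintegral (fun t => f t * (g t)^*).

(* squared norm ||f||^2 *)
Definition sqnorm2 (f : R -> R[i]) : R := complex.Re (inner f f).

(* e_k(z) = z^k, k an integer *)
Definition expo (k : int) (t : R) : R[i] :=
  Complex (cos (2 * pi * k%:~R * t)) (sin (2 * pi * k%:~R * t)).

(* the identity function z *)
Definition zeta : R -> R[i] := expo 1.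

(* H^2: L^2 functions whose negative Fourier coefficients vanish,
   \hat f(-n) = <f, e_{-n}> = 0 for n >= 1 *)
Definition H2 (f : R -> R[i]) : Prop :=
  L2 f /\ forall n : nat, (0 < n)%N -> inner f (expo (- (n%:Z))) = 0.

(* g is the orthogonal projection of h onto the (closed) subspace S *)
Definition is_proj (S : (R -> R[i]) -> Prop) (h g : R -> R[i]) : Prop :=
  S g /\ forall k, S k -> inner (fun t => h t - g t) k = 0.

(* the orthogonal projection onto S (chosen representative) *)
Definition hproj (S : (R -> R[i]) -> Prop) (h : R -> R[i]) : R -> R[i] :=
  match pselect (exists g, is_proj S h g) with
  | left e => proj1_sig (cid e)
  | right _ => h
  end.

(* P : L^2 -> H^2 *)
Definition PH2 := hproj H2.

(* Toeplitz operator T_phi f = P (phi f) *)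
Definition Toeplitz (phi f : R -> R[i]) : R -> R[i] :=
  PH2 (fun t => phi t * f t).

(* inner functions: alpha in H^infty = H^2 \cap L^infty with |alpha| = 1 a.e. *)
Definition inner_fun (a : R -> R[i]) : Prop :=
  H2 a /\ Linf a /\ ae_T (fun t => sqmod (a t) = 1).

Definition nonconstant (a : R -> R[i]) : Prop :=
  ~ exists c : R[i], ae_eqT a (fun _ => c).

(* model space K^2_alpha = H^2 \ominus alpha H^2 *)
Definition Kmodel (a : R -> R[i]) (f : R -> R[i]) : Prop :=
  H2 f /\ forall h, H2 h -> inner f (fun t => a t * h t) = 0.

(* P_alpha *)
Definition Pmodel (a : R -> R[i]) := hproj (Kmodel a).

(* conjugation C_alpha f (z) = alpha(z) conj(z f(z)) *)
Definition Cconj (a f : R -> R[i]) : R -> R[i] :=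
  fun t => a t * (zeta t * f t)^*.

(* compression A_alpha = P_alpha A |_{K^2_alpha} *)
Definition compress (a : R -> R[i]) (A : (R -> R[i]) -> (R -> R[i]))
  : (R -> R[i]) -> (R -> R[i]) :=
  fun f => Pmodel a (A f).

(* B = T^* on the subspace S (B maps S into S and <T f, g> = <f, B g>) *)
Definition is_adjoint_on (S : (R -> R[i]) -> Prop)
  (T B : (R -> R[i]) -> (R -> R[i])) : Prop :=
  (forall g, S g -> S (B g)) /\
  forall f g, S f -> S g -> inner (T f) g = inner f (B g).

(* A is a bounded linear operator on H^2 *)
Definition bounded_linear_H2 (A : (R -> R[i]) -> (R -> R[i])) : Prop :=
  [/\ forall f, H2 f -> H2 (A f),
      forall f g, H2 f -> H2 g ->
        ae_eqT (A (fun t => f t + g t)) (fun t => A f t + A g t),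
      forall (c : R[i]) f, H2 f ->
        ae_eqT (A (fun t => c * f t)) (fun t => c * A f t)
    & exists M : R, forall f, H2 f -> sqnorm2 (A f) <= M * sqnorm2 f].

End Hardy.

(* Main.v *)
(* On functions f, g of the model space, the identity C A_a C = A_a^* says
   <A f, g> = <A (C g), C f>.  When A = T_phi this is immediate from
   |a| = |z| = 1.  Conversely, for a = z^n the conjugation exchanges z^i and
   z^(n-1-i), so taking n = i + j + 2 the identity reads
   <A z^i, z^j> = <A z^(i+1), z^(j+1)>: the matrix of A is a Toeplitz matrix,
   and the Brown-Halmos theorem applies.

   For Brown-Halmos, put phi_n = z^(-n) A z^n.  The Toeplitz relation makes
   phi_m - phi_n orthogonal to phi_n for n <= m, hence
   |phi_m - phi_n|^2 = |phi_m|^2 - |phi_n|^2 and phi_n converges in L^2 to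
   some phi.  For a trigonometric polynomial p, z^(-n) A (z^n p) tends to
   phi p, so |phi p|_2 <= |A| |p|_2, i.e. (|A|^2 - |phi|^2) |p|^2 has a
   nonnegative integral.

   A real integrable function h with int h |p|^2 >= 0 for all trigonometric
   polynomials p is nonnegative a.e.: with u = sin^2 (pi (t - c)), the
   polynomials (1 - u^n)^(n k^n) converge boundedly to the indicator of the
   arc {k u < 1}, and Lebesgue differentiation applies to these arcs.  This
   gives both the bound on phi and the completeness of the Fourier basis. *)
Require Import Defs.
From HB Require Import structures.
From mathcomp Require Import all_boot all_order all_algebra.
From mathcomp Require Import all_classical all_reals all_analysis.
From mathcomp Require Import complex.
From mathcomp Require Import measurable_realfun.
From mathcomp Require Import ring lra zify.

Set Implicit Arguments.
Unset Strict Implicit.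
Unset Printing Implicit Defensive.

Import Order.TTheory GRing.Theory Num.Theory.
Import numFieldNormedType.Exports.
Local Open Scope classical_set_scope.
Local Open Scope ring_scope.

(** * Real and imaginary parts, conjugation and squared modulus *)

Section ComplexFacts.
Variable R : realType.
Implicit Types (z w : R[i]).
Local Notation Re := (@complex.Re R).
Local Notation Im := (@complex.Im R).

Lemma ReM z w : Re (z * w) = Re z * Re w - Im z * Im w.
Proof. by case: z; case: w. Qed.

Lemma ImM z w : Im (z * w) = Re z * Im w + Im z * Re w.
Proof. by case: z; case: w. Qed.

Lemma Re_conj z : Re z^* = Re z. Proof. by case: z. Qed.
Lemma Im_conj z : Im z^* = - Im z. Proof. by case: z. Qed.
Lemma ReD z w : Re (z + w) = Re z + Re w. Proof. by case: z; case: w. Qed.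
Lemma ImD z w : Im (z + w) = Im z + Im w. Proof. by case: z; case: w. Qed.
Lemma ReN z : Re (- z) = - Re z. Proof. by case: z. Qed.
Lemma ImN z : Im (- z) = - Im z. Proof. by case: z. Qed.

Lemma complexP z w : Re z = Re w -> Im z = Im w -> z = w.
Proof. by case: z w => [a b] [c d] /= -> ->. Qed.

Definition ReImE := (ReM, ImM, Re_conj, Im_conj, ReD, ImD, ReN, ImN).

Lemma cconjD z w : (z + w)^* = z^* + w^*.
Proof. by apply: complexP; rewrite !ReImE//; ring. Qed.

Lemma cconjB z w : (z - w)^* = z^* - w^*.
Proof. by apply: complexP; rewrite !ReImE//; ring. Qed.

Lemma cconjM z w : (z * w)^* = z^* * w^*.
Proof. by apply: complexP; rewrite !ReImE; ring. Qed.

Lemma cconjK z : z^*^* = z.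
Proof. by apply: complexP; rewrite !ReImE//; ring. Qed.

Lemma sqmod_ge0 z : 0 <= sqmod z.
Proof. by rewrite addr_ge0// sqr_ge0. Qed.

Lemma sqmodM z w : sqmod (z * w) = sqmod z * sqmod w.
Proof. by rewrite /sqmod !ReImE; ring. Qed.

Lemma sqmod_conj z : sqmod z^* = sqmod z.
Proof. by rewrite /sqmod !ReImE; ring. Qed.

Lemma sqmodN z : sqmod (- z) = sqmod z.
Proof. by rewrite /sqmod !ReImE; ring. Qed.

Lemma mulconj z : z * z^* = (sqmod z)%:C%C.
Proof. by apply: complexP; rewrite /sqmod !ReImE/=; ring. Qed.

Lemma sqmod_eq0 z : sqmod z = 0 -> z = 0.
Proof.
move=> /eqP; rewrite paddr_eq0 ?sqr_ge0// !sqrf_eq0 => /andP[/eqP a /eqP b].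
exact: complexP.
Qed.

(** The parallelogram law with the term [sqmod (z - w)] dropped. It stands in for the triangle
    inequality and avoids square roots. *)
Lemma sqmodD_le z w : sqmod (z + w) <= 2 * sqmod z + 2 * sqmod w.
Proof.
have := sqmod_ge0 (z - w); rewrite /sqmod !ReImE; nra.
Qed.

End ComplexFacts.

(** * Square-integrable functions on the circle *)

Section Integration.
Variable R : realType.
Implicit Types (f g h k : R -> R[i]).
Local Notation Re := (@complex.Re R).
Local Notation Im := (@complex.Im R).
Local Notation mu := (@lebesgue_measure R).
Local Notation D := (@Tpar R).

(* [lebesgue_measure] lives on [measurableTypeR R], whose sigma-algebra is
   convertible to the canonical one on [R] but carries another display. *)
Lemma measurable_Tpar : measurable (D : set (measurableTypeR R)).
Proof. exact: measurable_itv. Qed.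
#[local] Hint Resolve measurable_Tpar : core.

Lemma measurable_EFin_Tpar (u : R -> R) : measurable_fun D u ->
  measurable_fun (D : set (measurableTypeR R)) (EFin \o u).
Proof. by move=> h; apply/measurable_EFinP. Qed.

Lemma lebesgue_Tpar : mu D = 1%E.
Proof. by rewrite /Tpar lebesgue_measure_itv/= lte_fin ltr01 oppr0 adde0. Qed.

Definition cintegrable f :=
  mu.-integrable D (EFin \o (Re \o f)) /\ mu.-integrable D (EFin \o (Im \o f)).

Lemma cmeasurable_cst (c : R[i]) : cmeasurable (fun _ => c).
Proof. by split; exact: measurable_cst. Qed.

Lemma cmeasurableD f g : cmeasurable f -> cmeasurable g ->
  cmeasurable (fun t => f t + g t).
Proof.
move=> [f1 f2] [g1 g2]; split.
- by under eq_fun do rewrite ReD; exact: measurable_funD.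
- by under eq_fun do rewrite ImD; exact: measurable_funD.
Qed.

Lemma cmeasurableM f g : cmeasurable f -> cmeasurable g ->
  cmeasurable (fun t => f t * g t).
Proof.
move=> [f1 f2] [g1 g2]; split.
- by under eq_fun do rewrite ReM; apply: measurable_funB; exact: measurable_funM.
- by under eq_fun do rewrite ImM; apply: measurable_funD; exact: measurable_funM.
Qed.

Lemma cmeasurable_conj f : cmeasurable f -> cmeasurable (fun t => (f t)^*).
Proof.
move=> [f1 f2]; split.
- by under eq_fun do rewrite Re_conj.
- by under eq_fun do rewrite Im_conj; exact: measurableT_comp.
Qed.

Lemma cmeasurableB f g : cmeasurable f -> cmeasurable g ->
  cmeasurable (fun t => f t - g t).
Proof.
move=> [f1 f2] [g1 g2]; split.
- by under eq_fun do rewrite ReD ReN; exact: measurable_funB.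
- by under eq_fun do rewrite ImD ImN; exact: measurable_funB.
Qed.

Lemma measurable_sqmod f : cmeasurable f -> measurable_fun D (fun t => sqmod (f t)).
Proof.
by move=> [f1 f2]; apply: measurable_funD; exact: measurable_funX.
Qed.

Let ae_filter : Filter (nbhs (almost_everywhere mu)).
Proof. exact: ae_filter_ringOfSetsType. Qed.
#[local] Existing Instance ae_filter.

Lemma ae_T_and (P Q : R -> Prop) : ae_T P -> ae_T Q -> ae_T (fun t => P t /\ Q t).
Proof.
by rewrite /ae_T => hP hQ; apply: (filterS2 _ _ hP hQ) => t p q Dt; split; [exact: p|exact: q].
Qed.

Lemma ae_T_imp (P Q : R -> Prop) : (forall t, D t -> P t -> Q t) -> ae_T P -> ae_T Q.
Proof. by rewrite /ae_T => PQ; apply: filterS => t p Dt; apply: PQ => //; exact: p. Qed.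

Lemma ae_T_all (P : R -> Prop) : (forall t, D t -> P t) -> ae_T P.
Proof. by move=> p; apply: aeW. Qed.

Lemma ae_eqT_trans f g h : ae_eqT f g -> ae_eqT g h -> ae_eqT f h.
Proof.
by move=> fg gh; apply: ae_T_imp (ae_T_and fg gh) => t _ [-> ->].
Qed.

Lemma Rintegral_ae (u v : R -> R) : measurable_fun D u -> measurable_fun D v ->
  ae_T (fun t => u t = v t) ->
  Rintegral mu D u = Rintegral mu D v.
Proof.
move=> mu_ mv uv; congr fine; apply: ae_eq_integral => //.
- by apply: measurable_EFin_Tpar.
- by apply: measurable_EFin_Tpar.
- by rewrite /ae_T in uv; apply: filterS uv => t h Dt /=; rewrite h.
Qed.

Lemma cintegral_ae f g : cmeasurable f -> cmeasurable g -> ae_eqT f g ->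
  cintegral f = cintegral g.
Proof.
move=> [f1 f2] [g1 g2] fg; rewrite /cintegral.
by congr Complex; apply: Rintegral_ae => //; apply: ae_T_imp fg => t _ ->.
Qed.

Lemma eq_cintegral f g : (forall t, D t -> f t = g t) -> cintegral f = cintegral g.
Proof.
move=> fg; rewrite /cintegral.
by congr Complex; apply: eq_Rintegral => t; rewrite inE => /fg ->.
Qed.

Lemma cintegralD f g : cintegrable f -> cintegrable g ->
  cintegral (fun t => f t + g t) = cintegral f + cintegral g.
Proof.
move=> [f1 f2] [g1 g2]; rewrite /cintegral.
under eq_Rintegral do rewrite ReD.
under [X in Complex _ X]eq_Rintegral do rewrite ImD.
by rewrite !RintegralD.
Qed.

Lemma integrable_Zl (u : R -> R) (r : R) : mu.-integrable D (EFin \o u) ->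
  mu.-integrable D (EFin \o (fun t => r * u t)).
Proof.
move=> iu; have := integrableZl measurable_Tpar r iu; congr (mu.-integrable _ _).
Qed.

Lemma integrable_D (u v : R -> R) : mu.-integrable D (EFin \o u) ->
  mu.-integrable D (EFin \o v) -> mu.-integrable D (EFin \o (fun t => u t + v t)).
Proof.
move=> iu iv; have := integrableD measurable_Tpar iu iv; congr (mu.-integrable _ _).
Qed.

Lemma integrable_B (u v : R -> R) : mu.-integrable D (EFin \o u) ->
  mu.-integrable D (EFin \o v) -> mu.-integrable D (EFin \o (fun t => u t - v t)).
Proof.
move=> iu iv; have := integrableB measurable_Tpar iu iv; congr (mu.-integrable _ _).
Qed.

Lemma cintegralZ f (c : R[i]) : cintegrable f ->
  cintegral (fun t => c * f t) = c * cintegral f.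
Proof.
move=> [f1 f2]; apply: complexP; rewrite !ReImE/=.
- under eq_Rintegral do rewrite ReM.
  by rewrite RintegralB ?RintegralZl//; exact: integrable_Zl.
- under eq_Rintegral do rewrite ImM.
  by rewrite RintegralD ?RintegralZl//; exact: integrable_Zl.
Qed.

Lemma cintegral_conj f : cintegrable f ->
  cintegral (fun t => (f t)^*) = (cintegral f)^*.
Proof.
move=> [f1 f2]; apply: complexP; rewrite !ReImE/=.
- by under eq_Rintegral do rewrite Re_conj.
- under eq_Rintegral do rewrite Im_conj -mulN1r.
  by rewrite RintegralZl// mulN1r.
Qed.

Lemma L2_integrable f : L2 f -> mu.-integrable D (EFin \o (fun t => sqmod (f t))).
Proof.
move=> [mf foo]; apply/integrableP; split.
  by apply: measurable_EFin_Tpar; exact: measurable_sqmod.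
apply: le_lt_trans foo; rewrite le_eqVlt; apply/orP; left; apply/eqP.
by apply: eq_integral => t _ /=; rewrite ger0_norm// sqmod_ge0.
Qed.

(** Sums, products with bounded functions and the limit in [L2_complete_fast] all enter L^2 through
    this criterion. The bound holds only almost everywhere because [Linf] bounds do. *)
Lemma L2_dominated f (u : R -> R) : cmeasurable f -> mu.-integrable D (EFin \o u) ->
  ae_T (fun t => sqmod (f t) <= u t) -> L2 f.
Proof.
move=> mf iu fu; split=> //.
have /integrableP[mu_ uoo] := iu; apply: le_lt_trans uoo.
apply: ae_ge0_le_integral => //.
- by move=> t _; rewrite lee_fin sqmod_ge0.
- by apply: measurable_EFin_Tpar; exact: measurable_sqmod.
- exact/measurableT_comp.
- rewrite /ae_T in fu; apply: filterS fu => t h Dt /=; rewrite lee_fin.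
  by apply: le_trans (h Dt) _; exact: ler_norm.
Qed.

Lemma L2_cst (c : R[i]) : L2 (fun _ => c).
Proof.
split; first exact: cmeasurable_cst.
rewrite integral_cst// [X in (_ * X < _)%E](_ : _ = 1%E); last exact: lebesgue_Tpar.
by rewrite mule1 ltry.
Qed.

Lemma L2D f g : L2 f -> L2 g -> L2 (fun t => f t + g t).
Proof.
move=> hf hg; apply: (@L2_dominated _ (fun t => 2 * sqmod (f t) + 2 * sqmod (g t))).
- by apply: cmeasurableD; [case: hf|case: hg].
- by apply: integrable_D; apply: integrable_Zl; exact: L2_integrable.
- by apply: ae_T_all => t _; exact: sqmodD_le.
Qed.

Lemma L2_Linf f g : Linf f -> L2 g -> L2 (fun t => f t * g t).
Proof.
move=> [mf [M fM]] hg; apply: (@L2_dominated _ (fun t => M * sqmod (g t))).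
- by apply: cmeasurableM => //; case: hg.
- by apply: integrable_Zl; exact: L2_integrable.
- by apply: ae_T_imp fM => t _ h; rewrite sqmodM ler_wpM2r ?sqmod_ge0.
Qed.

Lemma Linf_cst (c : R[i]) : Linf (fun _ => c).
Proof.
split; [exact: cmeasurable_cst|exists (sqmod c)].
exact: ae_T_all.
Qed.

Lemma L2Z f (c : R[i]) : L2 f -> L2 (fun t => c * f t).
Proof. exact/L2_Linf/Linf_cst. Qed.

Lemma L2B f g : L2 f -> L2 g -> L2 (fun t => f t - g t).
Proof.
move=> hf hg; rewrite (_ : (fun t => _) = fun t => f t + (-1) * g t).
  by apply: L2D => //; exact: L2Z.
by apply/funext => t; rewrite mulN1r.
Qed.

Lemma L2_conj f : L2 f -> L2 (fun t => (f t)^*).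
Proof.
move=> [mf foo]; split; first exact: cmeasurable_conj.
by under eq_integral do rewrite sqmod_conj.
Qed.

Lemma L2_cintegrable f g : L2 f -> L2 g -> cintegrable (fun t => f t * (g t)^*).
Proof.
move=> hf hg.
have iS : mu.-integrable D (EFin \o (fun t => sqmod (f t) + sqmod (g t))).
  by apply: integrable_D; exact: L2_integrable.
have [m1 m2] : cmeasurable (fun t => f t * (g t)^*).
  by apply: cmeasurableM; [case: hf|apply: cmeasurable_conj; case: hg].
have aux (a b c d : R) : `|a * b - c * (- d)| <= (a ^+ 2 + c ^+ 2) + (b ^+ 2 + d ^+ 2).
  rewrite ler_norml.
  have := sqr_ge0 (a + b); have := sqr_ge0 (c + d).
  have := sqr_ge0 (a - b); have := sqr_ge0 (c - d).
  by move=> *; apply/andP; split; nra.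
have aux' (a b c d : R) : `|a * (- d) + c * b| <= (a ^+ 2 + c ^+ 2) + (b ^+ 2 + d ^+ 2).
  rewrite ler_norml.
  have := sqr_ge0 (a + d); have := sqr_ge0 (c + b).
  have := sqr_ge0 (a - d); have := sqr_ge0 (c - b).
  by move=> *; apply/andP; split; nra.
split; apply: (le_integrable measurable_Tpar _ _ iS).
- exact: (measurable_EFin_Tpar m1).
- move=> t Dt /=; rewrite lee_fin [X in _ <= X]ger0_norm ?addr_ge0 ?sqr_ge0//.
  by rewrite !ReImE; exact: aux.
- exact: (measurable_EFin_Tpar m2).
- move=> t Dt /=; rewrite lee_fin [X in _ <= X]ger0_norm ?addr_ge0 ?sqr_ge0//.
  by rewrite !ReImE; exact: aux'.
Qed.

End Integration.

(** * Inner product of L^2, Cauchy-Schwarz and norm limits *)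

Section InnerProduct.
Variable R : realType.
Implicit Types (f g h k : R -> R[i]).
Local Notation Re := (@complex.Re R).
Local Notation mu := (@lebesgue_measure R).
Local Notation D := (@Tpar R).

Lemma innerDl f g h : L2 f -> L2 g -> L2 h ->
  inner (fun t => f t + g t) h = inner f h + inner g h.
Proof.
move=> hf hg hh; rewrite /inner -cintegralD; try exact: L2_cintegrable.
by apply: eq_cintegral => t _; rewrite mulrDl.
Qed.

Lemma innerZl f g (c : R[i]) : L2 f -> L2 g ->
  inner (fun t => c * f t) g = c * inner f g.
Proof.
move=> hf hg; rewrite /inner -cintegralZ; last exact: L2_cintegrable.
by apply: eq_cintegral => t _; rewrite mulrA.
Qed.

Lemma innerC f g : L2 f -> L2 g -> inner g f = (inner f g)^*.
Proof.
move=> hf hg; rewrite /inner -cintegral_conj; last exact: L2_cintegrable.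
by apply: eq_cintegral => t _; apply: complexP; rewrite !ReImE; ring.
Qed.

Lemma innerBl f g h : L2 f -> L2 g -> L2 h ->
  inner (fun t => f t - g t) h = inner f h - inner g h.
Proof.
move=> hf hg hh; rewrite -[- inner g h]mulN1r -innerZl//.
rewrite -innerDl//; last exact: L2Z.
by congr inner; apply/funext => t; rewrite mulN1r.
Qed.

Lemma innerDr f g h : L2 f -> L2 g -> L2 h ->
  inner h (fun t => f t + g t) = inner h f + inner h g.
Proof.
move=> hf hg hh; rewrite innerC ?innerDl//; last exact: L2D.
by rewrite cconjD -!innerC.
Qed.

Lemma innerZr f g (c : R[i]) : L2 f -> L2 g ->
  inner g (fun t => c * f t) = c^* * inner g f.
Proof.
move=> hf hg; rewrite innerC ?innerZl//; last exact: L2Z.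
by rewrite cconjM -innerC.
Qed.

Lemma innerBr f g h : L2 f -> L2 g -> L2 h ->
  inner h (fun t => f t - g t) = inner h f - inner h g.
Proof.
move=> hf hg hh; rewrite innerC ?innerBl//; last exact: L2B.
by rewrite cconjB -!innerC.
Qed.

Lemma inner0l f : inner (fun=> 0) f = 0.
Proof.
apply: complexP => /=; under eq_Rintegral do rewrite mul0r/=;
  by rewrite Rintegral_cst ?mul0r//; exact: measurable_Tpar.
Qed.

Lemma inner_ae f f' g g' : L2 f -> L2 f' -> L2 g -> L2 g' ->
  ae_eqT f f' -> ae_eqT g g' -> inner f g = inner f' g'.
Proof.
move=> [mf _] [mf' _] [mg _] [mg' _] ff' gg'; apply: cintegral_ae.
- by apply: cmeasurableM => //; exact: cmeasurable_conj.
- by apply: cmeasurableM => //; exact: cmeasurable_conj.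
- by apply: ae_T_imp (ae_T_and ff' gg') => t _ [-> ->].
Qed.

Lemma sqnorm2E f : sqnorm2 f = Rintegral mu D (fun t => sqmod (f t)).
Proof. by apply: eq_Rintegral => t _; rewrite mulconj. Qed.

Lemma inner_self f : inner f f = (sqnorm2 f)%:C%C.
Proof.
apply: complexP => //=.
rewrite (_ : Rintegral _ _ _ = Rintegral mu D (fun=> 0)).
  by rewrite Rintegral_cst ?mul0r//; exact: measurable_Tpar.
by apply: eq_Rintegral => t _; rewrite mulconj.
Qed.

Lemma sqnorm2_ge0 f : 0 <= sqnorm2 f.
Proof. by rewrite sqnorm2E; apply: Rintegral_ge0 => t _; exact: sqmod_ge0. Qed.

Lemma sqnorm2_eq0 f : L2 f -> sqnorm2 f = 0 -> ae_eqT f (fun=> 0).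
Proof.
move=> hf; rewrite sqnorm2E => f0.
have iL := L2_integrable hf.
have e0 : (\int[mu]_(t in D) `|(EFin \o (fun t => sqmod (f t))) t| = 0)%E.
  transitivity (\int[mu]_(t in D) (sqmod (f t))%:E)%E.
    by apply: eq_integral => t _ /=; rewrite ger0_norm// sqmod_ge0.
  have := integrable_fin_num (@measurable_Tpar R) iL.
  by move=> /fineK <-; rewrite [X in X%:E]f0.
have /integrableP[mL _] := iL.
move/(ae_eq_integral_abs _ (@measurable_Tpar R) mL) : e0.
apply: (@ae_T_imp R (fun t => (sqmod (f t))%:E = 0%E)) => t _ [] /=.
exact: sqmod_eq0.
Qed.

Lemma sqnorm2_ae f g : L2 f -> L2 g -> ae_eqT f g -> sqnorm2 f = sqnorm2 g.
Proof. by move=> hf hg fg; rewrite /sqnorm2 (inner_ae hf hg hf hg). Qed.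

Lemma sqnorm2Z f (c : R[i]) : L2 f -> sqnorm2 (fun t => c * f t) = sqmod c * sqnorm2 f.
Proof.
move=> hf; rewrite /sqnorm2 innerZl ?innerZr//; last exact: L2Z.
by rewrite mulrA mulconj inner_self/= mul0r subr0.
Qed.

Lemma sqnorm2N f g : L2 f -> L2 g ->
  sqnorm2 (fun t => f t - g t) = sqnorm2 (fun t => g t - f t).
Proof.
by move=> hf hg; rewrite !sqnorm2E; apply: eq_Rintegral => t _; rewrite -sqmodN opprB.
Qed.

Lemma sqnorm2D f g : L2 f -> L2 g ->
  sqnorm2 (fun t => f t + g t) = sqnorm2 f + sqnorm2 g + 2 * Re (inner f g).
Proof.
move=> hf hg; rewrite /sqnorm2 innerDl ?innerDr//; last exact: L2D.
by rewrite (innerC hf hg) !ReImE; ring.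
Qed.

Lemma sqnorm2B f g : L2 f -> L2 g ->
  sqnorm2 (fun t => f t - g t) = sqnorm2 f + sqnorm2 g - 2 * Re (inner f g).
Proof.
move=> hf hg; rewrite /sqnorm2 innerBl ?innerBr//; last exact: L2B.
by rewrite (innerC hf hg) !ReImE; ring.
Qed.

Lemma sqnorm2D_le f g : L2 f -> L2 g ->
  sqnorm2 (fun t => f t + g t) <= 2 * sqnorm2 f + 2 * sqnorm2 g.
Proof.
move=> hf hg; have := sqnorm2_ge0 (fun t => f t - g t).
rewrite sqnorm2B// sqnorm2D//; lra.
Qed.

Lemma sqnorm2B_le f g h : L2 f -> L2 g -> L2 h ->
  sqnorm2 (fun t => f t - h t) <=
  2 * sqnorm2 (fun t => f t - g t) + 2 * sqnorm2 (fun t => g t - h t).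
Proof.
move=> hf hg hh.
rewrite (_ : (fun t => f t - h t) = fun t => (f t - g t) + (g t - h t)).
  by apply: sqnorm2D_le; exact: L2B.
by apply/funext => t; ring.
Qed.

(** With c = <f, g>, the polynomial |f - s c g|^2 >= 0 in the real variable s is evaluated at s = 1
    / |g|^2. If |g| = 0 it is affine in s, and a large s excludes c <> 0. *)
Lemma cauchy_schwarz f g : L2 f -> L2 g ->
  sqmod (inner f g) <= sqnorm2 f * sqnorm2 g.
Proof.
move=> hf hg; set c := inner f g.
have key (s : R) : 0 <= sqnorm2 f + s ^+ 2 * (sqmod c * sqnorm2 g) - 2 * s * sqmod c.
  have := sqnorm2_ge0 (fun t => f t - (s%:C%C * c) * g t).
  rewrite sqnorm2B//; last exact: L2Z.
  rewrite sqnorm2Z// innerZr// -/c sqmodM.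
  suff -> : Re ((s%:C%C * c)^* * c) = s * sqmod c.
    by rewrite {1}/sqmod/= expr0n addr0; lra.
  by rewrite /sqmod !ReImE/=; ring.
have [g0|g0] := eqVneq (sqnorm2 g) 0.
  rewrite g0 mulr0 leNgt; apply/negP => c0.
  have := key ((sqnorm2 f + 1) / sqmod c).
  rewrite g0 !mulr0 addr0 -mulrA divfK ?gt_eqF//.
  have := sqnorm2_ge0 f; lra.
have gp : 0 < sqnorm2 g by rewrite lt_neqAle eq_sym g0 sqnorm2_ge0.
have := key (sqnorm2 g)^-1; rewrite expr2 -!mulrA.
rewrite (mulrCA _ (sqmod c)) mulVf// mulr1 => h.
rewrite -ler_pdivrMr// [_ / _]mulrC; lra.
Qed.

Definition L2lim (u : nat -> R -> R[i]) f := forall e, 0 < e ->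
  exists N, forall n, (N <= n)%N -> sqnorm2 (fun t => u n t - f t) <= e.

(** Cauchy-Schwarz makes <-, g> continuous. The values are eventually constant because the lemma
    carries orthogonality relations and matrix entries to the limit. *)
Lemma L2lim_inner (u : nat -> R -> R[i]) f g (c : R[i]) :
  (forall n, L2 (u n)) -> L2 f -> L2 g -> L2lim u f ->
  (exists N, forall n, (N <= n)%N -> inner (u n) g = c) -> inner f g = c.
Proof.
move=> hu hf hg uf [N1 h1]; apply/eqP; rewrite -subr_eq0; apply/eqP/sqmod_eq0.
apply/eqP; rewrite eq_le sqmod_ge0 andbT; apply/ler_addgt0Pr => e e0; rewrite add0r.
(* The [+ 1] keeps the denominator positive when [g] vanishes. *)
have [N2 h2] := uf (e / (sqnorm2 g + 1)) (divr_gt0 e0 (ltr_wpDl (sqnorm2_ge0 g) ltr01)).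
pose n := maxn N1 N2.
have := cauchy_schwarz (L2B (hu n) hf) hg.
rewrite innerBl// h1 ?leq_maxl// -sqmodN opprB => /le_trans; apply.
have := h2 n (leq_maxr _ _); have g0 := sqnorm2_ge0 g.
rewrite ler_pdivlMr; last lra.
move=> h; apply: le_trans h; apply: ler_wpM2l; first exact: sqnorm2_ge0.
lra.
Qed.

(** Expanding |(u n - f) + f|^2 and bounding the cross term by Cauchy-Schwarz gives |f|^2 <= |u n|^2
    + 2 |f| |u n - f|, whose last term tends to 0. *)
Lemma L2lim_sqnorm2_le (u : nat -> R -> R[i]) f (M : R) :
  (forall n, L2 (u n)) -> L2 f -> L2lim u f ->
  (exists N, forall n, (N <= n)%N -> sqnorm2 (u n) <= M) -> sqnorm2 f <= M.
Proof.
move=> hu hf uf [N1 h1].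
have key (n : nat) : sqnorm2 f <= sqnorm2 (u n) +
    (2 * Num.sqrt (sqnorm2 f) * Num.sqrt (sqnorm2 (fun t => u n t - f t))).
  have H : Re (inner (fun t => u n t - f t) f) ^+ 2 <=
      sqnorm2 (fun t => u n t - f t) * sqnorm2 f.
    apply: le_trans (cauchy_schwarz (L2B (hu n) hf) hf).
    by rewrite /sqmod lerDl sqr_ge0.
  have H2 : - Re (inner (fun t => u n t - f t) f) <=
      Num.sqrt (sqnorm2 f) * Num.sqrt (sqnorm2 (fun t => u n t - f t)).
    rewrite -sqrtrM ?sqnorm2_ge0// mulrC.
    apply: le_trans (ler_norm _) _; rewrite normrN -sqrtr_sqr.
    by rewrite ler_sqrt ?mulr_ge0 ?sqnorm2_ge0.
  have E : u n = fun t => (u n t - f t) + f t by apply/funext => t; rewrite subrK.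
  rewrite [in X in _ <= X + _]E sqnorm2D//; last exact: L2B.
  have := sqnorm2_ge0 (fun t => u n t - f t); lra.
apply/ler_addgt0Pr => e e0.
set b := Num.sqrt (sqnorm2 f); have b0 : 0 <= b by exact: sqrtr_ge0.
pose d := e / (2 * b + 1).
have d0 : 0 < d by apply: divr_gt0 => //; lra.
have [N2 h2] := uf (d ^+ 2) (exprn_gt0 _ d0).
pose n := maxn N1 N2; apply: le_trans (key n) _.
apply: lerD; first exact/h1/leq_maxl.
have : Num.sqrt (sqnorm2 (fun t => u n t - f t)) <= d.
  rewrite -[leRHS](gtr0_norm d0) -sqrtr_sqr ler_sqrt ?sqr_ge0//.
  exact/h2/leq_maxr.
move=> h; apply: le_trans (_ : 2 * b * d <= _).
  by apply: ler_wpM2l => //; lra.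
rewrite -/b /d mulrA ler_pdivrMr; last lra.
nra.
Qed.

End InnerProduct.

(** * Convergence of rapidly Cauchy sequences in L^2 *)

Section Completeness.
Variable R : realType.
Implicit Types (f g h : R -> R[i]).
Local Notation Re := (@complex.Re R).
Local Notation Im := (@complex.Im R).
Local Notation mu := (@lebesgue_measure R).
Local Notation D := (@Tpar R).

Lemma half_pow_small (C e : R) : 0 < e -> exists N, forall n, (N <= n)%N ->
  C * 2^-1 ^+ n <= e.
Proof.
move=> e0; have [C0|C0] := leP C 0.
  exists 0%N => n _; apply: le_trans (ltW e0).
  by rewrite mulr_le0_ge0// exprn_ge0.
have Ce : 0 <= C / e by rewrite divr_ge0// ltW.
exists (Num.bound (C / e)) => n Nn.
rewrite exprVn ler_pdivrMr ?exprn_gt0// -ler_pdivrMl// mulrC.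
apply: le_trans (ltW (archi_boundP Ce)) _.
apply: (@le_trans _ _ n%:R); first by rewrite ler_nat.
by rewrite -natrX ler_nat ltnW// ltn_expl.
Qed.

(** Induction on [m] splits off the first increment with [sqmodD_le]. The factor 2 lost each time is
    recovered from 2^-(N+1) = 2^-N / 2, which is why the increments carry the weights 2^k. *)
Lemma telescope_sqmod (z : nat -> R[i]) (N m : nat) :
  sqmod (z (N + m)%N - z N) <=
  2 * 2^-1 ^+ N * \sum_(N <= k < N + m) 2 ^+ k * sqmod (z k.+1 - z k).
Proof.
elim: m N => [|m IH] N.
  by rewrite addn0 subrr big_geq// mulr0 /sqmod/= expr0n addr0.
rewrite (_ : z (N + m.+1)%N - z N = (z (N + m.+1)%N - z N.+1) + (z N.+1 - z N)); last by ring.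
apply: le_trans (sqmodD_le _ _) _.
rewrite big_ltn ?addnS ?ltnS ?leq_addr// [leRHS]mulrDr [leLHS]addrC; apply: lerD.
  by rewrite mulrA -[2 * _ * _]mulrA -exprMn mulVf ?expr1n ?mulr1// pnatr_eq0.
rewrite -addSn; have := IH N.+1; rewrite exprS; set S := \sum_(_ <= _ < _) _; set q := 2^-1 ^+ N.
rewrite (_ : 2 * q * S = 2 * (2 * (2^-1 * q) * S)); last by field.
by move=> h; rewrite ler_pM2l.
Qed.

Lemma sqr_summable_cvg (x : nat -> R) (w : R) :
  (forall N m, (x (N + m)%N - x N) ^+ 2 <= w * 2^-1 ^+ N) -> cvgn x.
Proof.
move=> h; apply: cauchy_cvg; apply: cauchy_exP => e e0.
have [N hN] := half_pow_small w (exprn_gt0 2 (divr_gt0 e0 (ltr0Sn R 1))).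
exists (x N); exists N => // n /= Nn.
rewrite /ball/= distrC -(subnKC Nn).
have := le_trans (h N (n - N)%N) (hN N (leqnn _)).
rewrite -ler_sqrt ?sqr_ge0// !sqrtr_sqr (gtr0_norm (divr_gt0 e0 _))//.
by move=> /le_lt_trans; apply; rewrite ltr_pdivrMr// mulr_natr mulr2n ltrDl.
Qed.

(** [Rintegral] applies [fine], which is monotone only between finite values; so integrability of
    [u] is first deduced from that of [w]. *)
Lemma ae_le_Rintegral (u w : R -> R) : (forall t, 0 <= u t) ->
  measurable_fun D u -> (forall t, 0 <= w t) -> mu.-integrable D (EFin \o w) ->
  ae_T (fun t => u t <= w t) -> Rintegral mu D u <= Rintegral mu D w.
Proof.
move=> u0 mu_ w0 iw uw.
have ufin : mu.-integrable D (EFin \o u).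
  apply/integrableP; split; first exact: measurable_EFin_Tpar.
  have /integrableP[mw woo] := iw; apply: le_lt_trans woo.
  apply: ae_ge0_le_integral => //.
  - exact: measurable_Tpar.
  - by apply: measurableT_comp => //; exact: measurable_EFin_Tpar.
  - exact/measurableT_comp.
  - apply: (ae_T_imp _ uw) => t _ /=; rewrite lee_fin => h.
    by rewrite !ger0_norm.
rewrite /Rintegral fine_le//.
- exact: (integrable_fin_num (@measurable_Tpar R) ufin).
- exact: (integrable_fin_num (@measurable_Tpar R) iw).
- apply: ae_ge0_le_integral.
  - exact: measurable_Tpar.
  - by move=> t _; rewrite lee_fin.
  - exact: measurable_EFin_Tpar.
  - by move=> t _; rewrite lee_fin.
  - by have /integrableP[] := iw.
  - by apply: (ae_T_imp _ uw) => t _ /=; rewrite lee_fin.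
Qed.

(* The integrable function [W = sum_k 2^k |v (k+1) - v k|^2] controls everything:
   by [telescope_sqmod], [|v m - v N|^2 <= 2^(1-N) W] pointwise for [N <= m]. *)
Lemma L2_complete_fast (v : nat -> R -> R[i]) : (forall n, L2 (v n)) ->
  (forall n, sqnorm2 (fun t => v n.+1 t - v n t) <= (2^-1 ^+ n) ^+ 2) ->
  exists g, L2 g /\ forall N, sqnorm2 (fun t => v N t - g t) <= 4 * 2^-1 ^+ N.
Proof.
move=> hv fast.
pose w (k : nat) t := 2 ^+ k * sqmod (v k.+1 t - v k t).
have w0 (k : nat) t : 0 <= w k t by rewrite mulr_ge0 ?exprn_ge0 ?sqmod_ge0.
have iw (k : nat) : mu.-integrable D (EFin \o w k).
  by apply: integrable_Zl; apply: L2_integrable; exact: L2B.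
have mw (k : nat) : measurable_fun (D : set (measurableTypeR R)) (EFin \o w k).
  by have /integrableP[] := iw k.
pose W t := (\sum_(0 <= k <oo) (w k t)%:E)%E.
have W0 t : (0 <= W t)%E by apply: nneseries_ge0 => k _ _; rewrite lee_fin.
have mW : measurable_fun (D : set (measurableTypeR R)) W.
  have w0' (k : nat) (t : measurableTypeR R) : D t -> k \in xpredT -> (0 <= (w k t)%:E)%E.
    by rewrite lee_fin.
  exact: (ge0_emeasurable_sum w0' (fun k _ => mw k)).
(* Sum and integral are exchanged; the k-th term is at most 2^k 4^-k = 2^-k, and these add up to
   2. *)
have intW : (\int[mu]_(t in D) W t <= 2%:E)%E.
  have w0' (k : nat) (t : measurableTypeR R) : D t -> (0 <= (EFin \o w k) t)%E.
    by rewrite lee_fin.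
  rewrite (integral_nneseries mu (@measurable_Tpar R) mw w0').
  have /cvg_lim := @cvg_geometric_eseries_half R 2 0.
  rewrite expr0 divr1 => <- //.
  apply: lee_nneseries => [k _ _|k _].
    by apply: integral_ge0 => t _; rewrite lee_fin.
  rewrite -(fineK (integrable_fin_num (@measurable_Tpar R) (iw k))) lee_fin.
  rewrite [leLHS](_ : _ = 2 ^+ k * sqnorm2 (fun t => v k.+1 t - v k t)); last first.
    have iv := L2_integrable (L2B (hv k.+1) (hv k)).
    rewrite sqnorm2E; apply: etrans (RintegralZl (2 ^+ k) (@measurable_Tpar R) iv).
    by apply: congr1; apply: eq_integral.
  apply: le_trans (ler_wpM2l _ (fast k)) _; first exact: exprn_ge0.
  rewrite expr2 mulrA -exprMn mulfV ?pnatr_eq0// expr1n mul1r.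
  by rewrite addn1 expnS natrM invfM mulrA mulfV ?pnatr_eq0// mul1r natrX exprVn.
have iW : mu.-integrable D (EFin \o (fine \o W)).
  apply: (le_integrable (@measurable_Tpar R) (f := EFin \o (fine \o W)) (g := W)).
  - have mf : measurable_fun [set: \bar R] fine by exact: (@fine_measurable R setT measurableT).
    have mfW : measurable_fun D (fine \o W) := measurableT_comp mf mW.
    exact: (measurable_EFin_Tpar mfW).
  - move=> t _ /=; rewrite gee0_abs// ger0_norm ?fine_ge0//.
    by case: (W t) (W0 t) => //= r r0; rewrite leey.
  - apply/integrableP; split => //; apply: le_lt_trans (ltry 2).
    by apply: le_trans intW; under eq_integral do rewrite gee0_abs//.
have Wfin : ae_T (fun t => W t \is a fin_num).
  apply: (integrable_ae (@measurable_Tpar R)).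
  apply/integrableP; split => //; apply: le_lt_trans (ltry 2).
  by apply: le_trans intW; under eq_integral do rewrite gee0_abs//.
have intfW : Rintegral mu D (fine \o W) <= 2.
  rewrite -lee_fin; apply: le_trans intW.
  rewrite (fineK (integrable_fin_num (@measurable_Tpar R) iW)).
  apply: ge0_le_integral => //.
  - exact: measurable_Tpar.
  - by move=> t _; rewrite lee_fin fine_ge0.
  - by have /integrableP[] := iW.
  - by move=> t _ /=; case: (W t) (W0 t) => //= r r0; rewrite leey.
pose inW t := W t \is a fin_num.
(* Where [W] is finite the values [v n t] form a Cauchy sequence. The remaining set is null, and the
   value 0 there keeps [g] measurable. *)
pose g t : R[i] := if inW t
  then Complex (limn (fun n => Re (v n t))) (limn (fun n => Im (v n t))) else 0.
have Wsum t N m : inW t -> \sum_(N <= k < N + m) w k t <= fine (W t).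
  move=> fW; rewrite -lee_fin (fineK fW) -sumEFin.
  apply: le_trans (nneseries_lim_ge (u_ := fun k => (w k t)%:E) (m := 0) (N + m)%N _); last first.
    by move=> *; rewrite lee_fin.
  rewrite (big_cat_nat (leq0n N) (leq_addr m N))/=.
  by rewrite leeDr// sume_ge0// => k _; rewrite lee_fin.
have vW t N m : inW t -> sqmod (v (N + m)%N t - v N t) <= (2 * fine (W t)) * 2^-1 ^+ N.
  move=> fW; apply: le_trans (telescope_sqmod (fun n => v n t) N m) _.
  rewrite (mulrAC 2 (fine _)); apply: ler_wpM2l; first by rewrite mulr_ge0 ?exprn_ge0.
  exact: Wsum.
have cRe t : inW t -> (Re (v n t) @[n --> \oo] --> Re (g t)).
  move=> fW; rewrite /g fW /=; apply: (@sqr_summable_cvg _ (2 * fine (W t))) => N m.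
  by apply: le_trans (vW t N m fW); rewrite /sqmod !ReImE lerDl sqr_ge0.
have cIm t : inW t -> (Im (v n t) @[n --> \oo] --> Im (g t)).
  move=> fW; rewrite /g fW /=; apply: (@sqr_summable_cvg _ (2 * fine (W t))) => N m.
  by apply: le_trans (vW t N m fW); rewrite /sqmod !ReImE lerDr sqr_ge0.
pose E := D `&` [set t | W t \is a fin_num].
have mE : measurable (E : set (measurableTypeR R)).
  exact: (emeasurable_fin_num (@measurable_Tpar R) mW).
have mIE : measurable_fun D (\1_E : R -> R) by exact: measurable_indic.
(* Multiplying by the indicator of [E] turns convergence where [W] is finite into convergence at
   every point of [D]. *)
have mcvg (x : nat -> R -> R) (y : R -> R) : (forall n, measurable_fun D (x n)) ->
    (forall t, inW t -> x n t @[n --> \oo] --> y t) -> (forall t, ~~ inW t -> y t = 0) ->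
    measurable_fun D y.
  move=> mx xy y0.
  apply: (@measurable_fun_cvg _ _ R D (fun n t => x n t * \1_E t)).
    by move=> n; exact: measurable_funM.
  move=> t Dt; have [fW|nfW] := boolP (inW t).
    rewrite indicE mem_set//=; under eq_fun do rewrite mulr1.
    exact: xy.
  rewrite indicE memNset ?y0//=; last by case=> _; exact/negP.
  by under eq_fun do rewrite mulr0; exact: cvg_cst.
have mg : cmeasurable g.
  split.
  - apply: (mcvg (fun n t => Re (v n t))) => //.
      by move=> n; have [[]] := hv n.
    by move=> t /negbTE nfW; rewrite /g nfW.
  - apply: (mcvg (fun n t => Im (v n t))) => //.
      by move=> n; have [[]] := hv n.
    by move=> t /negbTE nfW; rewrite /g nfW.
(* The bound [vW] passes to the limit in the larger index, with [N] fixed. *)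
have vg t N : inW t -> sqmod (v N t - g t) <= 2 * 2^-1 ^+ N * (fine \o W) t.
  move=> fW; rewrite -sqmodN opprB /sqmod !ReImE.
  apply: (@cvgr_to_le nat \oo _ R (fun m => (Re (v m t) - Re (v N t)) ^+ 2 +
     (Im (v m t) - Im (v N t)) ^+ 2)).
    apply: cvgD; rewrite expr2; apply: cvgM; apply: cvgB;
      first [exact: cvg_cst|exact: cRe|exact: cIm].
  exists N => // m /= Nm; rewrite -(subnKC Nm).
  by have := vW t N (m - N)%N fW; rewrite /sqmod !ReImE mulrAC.
have vg' N : ae_T (fun t => sqmod (v N t - g t) <= 2 * 2^-1 ^+ N * (fine \o W) t).
  by apply: ae_T_imp Wfin => t _; exact: vg.
have hd N : L2 (fun t => v N t - g t).
  apply: (L2_dominated _ _ (vg' N)); last exact: integrable_Zl.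
  by apply: cmeasurableB => //; case: (hv N).
exists g; split.
  rewrite (_ : g = fun t => v 0%N t - (v 0%N t - g t)); first exact: L2B.
  by apply/funext => t; rewrite opprB addrC subrK.
move=> N; rewrite sqnorm2E.
apply: (@le_trans _ _ (Rintegral mu D (fun t => 2 * 2^-1 ^+ N * (fine \o W) t))).
  apply: ae_le_Rintegral => //.
  - by move=> t; exact: sqmod_ge0.
  - by apply: measurable_sqmod; case: (hd N).
  - by move=> t; rewrite !mulr_ge0 ?exprn_ge0 ?fine_ge0.
  - exact: integrable_Zl.
rewrite RintegralZl//; last exact: measurable_Tpar.
have : 0 <= 2^-1 ^+ N :> R by rewrite exprn_ge0.
move: intfW; set a := Rintegral _ _ _; set b := _ ^+ N; nra.
Qed.

End Completeness.

(** * Completeness of L^2 and orthogonal projection onto closed subspaces *)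

Section Projection.
Variable R : realType.
Implicit Types (f g h : R -> R[i]).
Local Notation Re := (@complex.Re R).

(** A subsequence with squared increments at most 4^-k converges by [L2_complete_fast], and the
    Cauchy property carries the whole sequence along. *)
Theorem L2_complete (u : nat -> R -> R[i]) : (forall n, L2 (u n)) ->
  (forall e, 0 < e -> exists N, forall m n, (N <= m)%N -> (N <= n)%N ->
     sqnorm2 (fun t => u m t - u n t) <= e) ->
  exists g, L2 g /\ L2lim u g.
Proof.
move=> hu cu.
have /choice[N hN] k : exists N, forall m n, (N <= m)%N -> (N <= n)%N ->
     sqnorm2 (fun t => u m t - u n t) <= (2^-1 ^+ k) ^+ 2.
  by apply: cu; rewrite !exprn_gt0.
(* The running maximum ensures that [M k] and [M k.+1] both lie beyond [N k], so that [hN k] applies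
   to consecutive terms. *)
pose M k := (\max_(j < k.+1) N j)%N.
have NM k : (N k <= M k)%N by apply: (leq_bigmax (ord_max : 'I_k.+1)).
have NMS k : (N k <= M k.+1)%N.
  by have := @leq_bigmax 'I_k.+2 (fun j => N j) (inord k); rewrite inordK.
have [|k|g [hg vg]] := @L2_complete_fast R (fun k => u (M k)).
- by move=> n; exact: hu.
- exact: hN.
exists g; split=> // e e0.
(* With q = 2^-K <= 1, the two halves of [sqnorm2B_le] contribute 2 q^2 <= 2 q and 2 (4 q), whence
   10. *)
have [K hK] := half_pow_small 10 e0.
exists (M K) => n Mn; apply: le_trans (hK K (leqnn _)).
apply: le_trans (sqnorm2B_le (hu n) (hu (M K)) hg) _.
have := vg K; have := hN K n (M K) (leq_trans (NM K) Mn) (NM K).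
have q0 : 0 <= 2^-1 ^+ K :> R by rewrite exprn_ge0.
have q1 : 2^-1 ^+ K <= 1 :> R by rewrite exprn_ile1// invf_le1// ler1n.
move: q0 q1; set q := 2^-1 ^+ K; nra.
Qed.

Lemma small_inv (e : R) : 0 < e -> exists N, forall n, (N <= n)%N -> n.+1%:R^-1 <= e.
Proof.
move=> e0; exists (Num.bound e^-1) => n Nn.
rewrite -[leRHS]invrK lef_pV2 ?posrE ?invr_gt0//.
have : e^-1 < (Num.bound e^-1)%:R by apply: archi_boundP; rewrite invr_ge0 ltW.
by move=> /ltW /le_trans; apply; rewrite ler_nat ltnW.
Qed.

(** A minimizing sequence for the distance from [h] to [S] is Cauchy by the parallelogram law, its
    limit attains the distance, and varying the minimizer along [k] gives orthogonality. *)
Theorem projection (S : (R -> R[i]) -> Prop) :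
  (forall f, S f -> L2 f) -> S (fun=> 0) ->
  (forall (c : R[i]) f g, S f -> S g -> S (fun t => f t + c * g t)) ->
  (forall u f, (forall n, S (u n)) -> L2 f -> L2lim u f -> S f) ->
  forall h, L2 h -> exists g, is_proj S h g.
Proof.
move=> SL2 S0 Slin Slim h hh.
pose E : set R := [set sqnorm2 (fun t => h t - k t) | k in S].
have Elb : has_lbound E by exists 0 => _ [k _ <-]; exact: sqnorm2_ge0.
have Einf : has_inf E by split => //; exists (sqnorm2 (fun t => h t - 0)), (fun=> 0).
pose d := inf E.
have dle k : S k -> d <= sqnorm2 (fun t => h t - k t).
  by move=> Sk; apply: ge_inf => //; exists k.
have /choice[u hu] n : exists k, S k /\ sqnorm2 (fun t => h t - k t) <= d + n.+1%:R^-1.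
  have := inf_adherent (_ : 0 < n.+1%:R^-1) Einf; rewrite invr_gt0 ltr0n => /(_ isT).
  by case=> _ [k Sk <-] /ltW; exists k.
have uS n := (hu n).1; have uL n := SL2 _ (uS n).
have uC m n : sqnorm2 (fun t => u m t - u n t) <= 2 * m.+1%:R^-1 + 2 * n.+1%:R^-1.
  pose a t := h t - u m t; pose b t := h t - u n t.
  have La : L2 a by exact: L2B.
  have Lb : L2 b by exact: L2B.
  have -> : (fun t => u m t - u n t) = (fun t => b t - a t).
    by apply/funext => t; rewrite /a/b; ring.
  (* The midpoint of [u m] and [u n], in the form f + c g that [Slin] provides; its squared distance
     to [h] is at least [d]. *)
  have Sk : S (fun t => 0 + (2^-1)%:C%C * (u m t + 1 * u n t)).
    by apply: (Slin (2^-1)%:C%C (fun=> 0)) => //; exact: Slin.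
  have := dle _ Sk.
  have -> : (fun t => h t - (0 + (2^-1)%:C%C * (u m t + 1 * u n t))) =
            (fun t => (2^-1)%:C%C * (b t + a t)).
    apply/funext => t; rewrite /a/b add0r mul1r.
    have {1}-> : h t = (2^-1)%:C%C * (h t + h t); last by ring.
    by apply: complexP; rewrite !ReImE/=; field.
  rewrite sqnorm2Z; last exact: L2D.
  rewrite sqnorm2D// sqnorm2B// {1}/sqmod/= expr0n addr0.
  rewrite (_ : 2^-1 ^+ 2 = 4^-1 :> R); last by field.
  have := (hu m).2; have := (hu n).2; rewrite -/a -/b.
  move: (m.+1%:R^-1) (n.+1%:R^-1) (sqnorm2 _) (sqnorm2 _) (Rintegral _ _ _) => x y p q r; lra.
have [g [Lg ug]] : exists g, L2 g /\ L2lim u g.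
  apply: L2_complete => // e e0.
  have e4 : 0 < e / 4 by rewrite divr_gt0.
  have [N hN] := small_inv e4.
  exists N => m n Nm Nn; apply: le_trans (uC m n) _.
  have := hN m Nm; have := hN n Nn.
  move: (m.+1%:R^-1) (n.+1%:R^-1) => x y; lra.
have Sg : S g by exact: (Slim u).
have Lhg : L2 (fun t => h t - g t) by exact: L2B.
have gd : sqnorm2 (fun t => h t - g t) <= d.
  apply/ler_addgt0Pr => e e0.
  apply: (@L2lim_sqnorm2_le R (fun n t => h t - u n t)) => //.
  - by move=> n; exact: L2B.
  - move=> e' e'0; have [N hN] := ug e' e'0; exists N => n Nn.
    have -> : (fun t => h t - u n t - (h t - g t)) = (fun t => g t - u n t).
      by apply/funext => t; ring.
    by rewrite sqnorm2N//; exact: hN.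
  - have [N hN] := small_inv e0; exists N => n Nn.
    by apply: le_trans (hu n).2 _; rewrite lerD2l hN.
exists g; split=> // k Sk.
have Lk := SL2 _ Sk.
set c := inner _ k.
(* Minimality is tested against g + s c k. At s = 1 / (|k|^2 + 1) the inequality fails unless c =
   0. *)
have key (s : R) : 0 < s -> 2 * sqmod c <= s * (sqmod c * sqnorm2 k).
  move=> s0.
  have Sk' := Slin (s%:C%C * c) g k Sg Sk.
  have := le_trans gd (dle _ Sk').
  have -> : (fun t => h t - (g t + (s%:C%C * c) * k t)) =
            (fun t => (h t - g t) - (s%:C%C * c) * k t).
    by apply/funext => t; ring.
  rewrite [X in _ <= X -> _]sqnorm2B//; last exact: L2Z.
  rewrite sqnorm2Z// innerZr// -/c sqmodM.
  have -> : Re ((s%:C%C * c)^* * c) = s * sqmod c.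
    by rewrite /sqmod !ReImE/=; ring.
  rewrite {1}/sqmod/= expr0n addr0 => H.
  rewrite -(ler_pM2l s0); move: H; lra.
apply: sqmod_eq0; apply/eqP; rewrite eq_le sqmod_ge0 andbT leNgt; apply/negP => c0.
have k1 : 0 < sqnorm2 k + 1 by rewrite ltr_wpDl ?sqnorm2_ge0.
have := key (sqnorm2 k + 1)^-1; rewrite invr_gt0 => /(_ k1).
rewrite [leRHS]mulrC ler_pdivlMr//; have := sqnorm2_ge0 k; nra.
Qed.

Lemma is_proj_unique (S : (R -> R[i]) -> Prop) h g g' :
  (forall f, S f -> L2 f) -> (forall f f', S f -> S f' -> S (fun t => f t - f' t)) ->
  L2 h -> is_proj S h g -> is_proj S h g' -> ae_eqT g g'.
Proof.
move=> SL2 SB hh [Sg pg] [Sg' pg'].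
have Sd := SB _ _ Sg Sg'.
have Lg := SL2 _ Sg; have Lg' := SL2 _ Sg'; have Ld := SL2 _ Sd.
suff /sqnorm2_eq0 : sqnorm2 (fun t => g t - g' t) = 0.
  move=> /(_ Ld); apply: ae_T_imp => t _ /eqP; rewrite subr_eq0 => /eqP; exact.
rewrite /sqnorm2 innerBl//.
have := pg _ Sd; have := pg' _ Sd; rewrite !innerBl// => /eqP.
by rewrite subr_eq0 => /eqP <- /eqP; rewrite subr_eq0 => /eqP <-; rewrite subrr.
Qed.

Lemma hproj_is_proj (S : (R -> R[i]) -> Prop) h :
  (exists g, is_proj S h g) -> is_proj S h (hproj S h).
Proof. by rewrite /hproj; case: pselect => // e _; exact: (proj2_sig (cid e)). Qed.

(** Both [H2] and the model spaces are of this form, so closedness and existence of projections are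
    proved once for all of them. *)
Definition annihilator (Q : (R -> R[i]) -> Prop) f :=
  L2 f /\ forall k, Q k -> inner f k = 0.

Lemma annihilator_lin (Q : (R -> R[i]) -> Prop) : (forall f, Q f -> L2 f) ->
  forall (c : R[i]) f g, annihilator Q f -> annihilator Q g ->
  annihilator Q (fun t => f t + c * g t).
Proof.
move=> QL c f g [Lf fQ] [Lg gQ]; split; first by apply: L2D => //; exact: L2Z.
move=> k Qk; have Lk := QL k Qk.
by rewrite innerDl// ?innerZl//; [rewrite fQ// gQ// mulr0 addr0|exact: L2Z].
Qed.

Lemma annihilator_lim (Q : (R -> R[i]) -> Prop) : (forall f, Q f -> L2 f) ->
  forall u f, (forall n, annihilator Q (u n)) -> L2 f -> L2lim u f -> annihilator Q f.
Proof.
move=> QL u f hu Lf uf; split=> // k Qk.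
apply: (L2lim_inner _ Lf (QL k Qk) uf); first by move=> n; case: (hu n).
by exists 0%N => n _; apply: (hu n).2.
Qed.

Lemma annihilator_proj (Q : (R -> R[i]) -> Prop) : (forall f, Q f -> L2 f) ->
  forall h, L2 h -> exists g, is_proj (annihilator Q) h g.
Proof.
move=> QL h; apply: projection.
- by move=> f [].
- split; first exact: L2_cst.
  by move=> k _; exact: inner0l.
- exact: annihilator_lin.
- exact: annihilator_lim.
Qed.

End Projection.

(** * Trigonometric polynomials *)

Section Fourier.
Variable R : realType.
Implicit Types (f g h p q : R -> R[i]) (k l : int).
Local Notation mu := (@lebesgue_measure R).
Local Notation D := (@Tpar R).

Lemma expoD k l t : expo (k + l) t = expo k t * expo l t :> R[i].
Proof.
by apply: complexP; rewrite !ReImE/= intrD mulrDr mulrDl (cosD, sinD)//; ring.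
Qed.

Lemma expoN k t : expo (- k) t = (expo k t)^* :> R[i].
Proof. by apply: complexP; rewrite !ReImE/= intrN mulrN mulNr (cosN, sinN). Qed.

Lemma expo0 t : expo 0 t = 1 :> R[i].
Proof. by apply: complexP; rewrite /= mulr0 mul0r (cos0, sin0). Qed.

Lemma expoXn n t : (zeta t) ^+ n = expo n%:Z t :> R[i].
Proof.
elim: n => [|n IH]; first by rewrite expr0 expo0.
by rewrite exprS IH -expoD; congr expo; rewrite -intS.
Qed.

Lemma sqmod_expo k t : sqmod (expo k t) = 1 :> R.
Proof. by rewrite /sqmod/= cos2Dsin2. Qed.

Lemma continuous_cos_lin (a : R) : continuous (fun t => cos (a * t)).
Proof.
move=> t; apply: continuous_comp; last exact: continuous_cos.
exact: mulrl_continuous.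
Qed.

Lemma continuous_sin_lin (a : R) : continuous (fun t => sin (a * t)).
Proof.
move=> t; apply: continuous_comp; last exact: continuous_sin.
exact: mulrl_continuous.
Qed.

Lemma cmeasurable_expo k : cmeasurable (@expo R k).
Proof.
split; apply: measurable_funTS; apply: continuous_measurable_fun.
- exact: continuous_cos_lin.
- exact: continuous_sin_lin.
Qed.

Lemma Linf_expo k : Linf (@expo R k).
Proof.
split; [exact: cmeasurable_expo|exists 1].
by apply: ae_T_all => t _; rewrite sqmod_expo.
Qed.

Lemma L2_expo k : L2 (@expo R k).
Proof.
rewrite (_ : expo k = fun t => expo k t * 1); last by apply/funext => t; rewrite mulr1.
by apply: L2_Linf; [exact: Linf_expo|exact: L2_cst].
Qed.

Lemma cos_2pi_int k : cos (2 * pi * k%:~R) = 1 :> R.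
Proof.
have cosn (n : nat) : cos (2 * pi * n%:R) = 1 :> R.
  by rewrite mulr_natr mulr_natl -[_ *+ n]add0r (periodicn (@cosD2pi R)) cos0.
by case: (intP k) => [|n|n]; rewrite ?intrN ?mulrN ?cosN; exact: cosn.
Qed.

Lemma sin_2pi_int k : sin (2 * pi * k%:~R) = 0 :> R.
Proof. by apply: cos1sin0; rewrite cos_2pi_int normr1. Qed.

Lemma Rintegral_cos_lin (a : R) : a != 0 ->
  Rintegral mu D (fun t => cos (a * t)) = sin a / a.
Proof.
move=> a0.
pose F (t : R) : R := a^-1 * sin (a * t).
have dF (x : R) : is_derive x (1 : R) F (cos (a * x)).
  by apply: is_derive_eq; rewrite /= /GRing.scale/=; field.
have cF : continuous F.
  by move=> x; apply: differentiable_continuous; apply/derivable1_diffP; case: (dF x).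
rewrite /Rintegral (@continuous_FTC2 R _ F)//.
- by rewrite -EFinB /F /= mulr1 mulr0 sin0 mulr0 subr0 mulrC.
- exact/continuous_subspaceT/continuous_cos_lin.
- split; first by move=> x _; case: (dF x).
  + exact/cvg_at_right_filter/cF.
  + exact/cvg_at_left_filter/cF.
- by move=> x _; rewrite derive1E; case: (dF x).
Qed.

Lemma Rintegral_sin_lin (a : R) : a != 0 ->
  Rintegral mu D (fun t => sin (a * t)) = (1 - cos a) / a.
Proof.
move=> a0.
pose F (t : R) : R := - a^-1 * cos (a * t).
have dF (x : R) : is_derive x (1 : R) F (sin (a * x)).
  by apply: is_derive_eq; rewrite /= /GRing.scale/=; field.
have cF : continuous F.
  by move=> x; apply: differentiable_continuous; apply/derivable1_diffP; case: (dF x).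
rewrite /Rintegral (@continuous_FTC2 R _ F)//.
- by rewrite -EFinB /F /= mulr1 mulr0 cos0 mulr1; field.
- exact/continuous_subspaceT/continuous_sin_lin.
- split; first by move=> x _; case: (dF x).
  + exact/cvg_at_right_filter/cF.
  + exact/cvg_at_left_filter/cF.
- by move=> x _; rewrite derive1E; case: (dF x).
Qed.

Lemma cintegral_expo k : cintegral (@expo R k) = (k == 0)%:R.
Proof.
have [->|k0] := eqVneq k 0.
  rewrite (@eq_cintegral R _ (fun=> 1)); last by move=> t _; exact: expo0.
  apply: complexP => /=; rewrite Rintegral_cst; try exact: measurable_Tpar.
    by rewrite mul1r; exact: (congr1 fine (lebesgue_Tpar R)).
  by rewrite mul0r.
have a0 : 2 * pi * k%:~R != 0 :> R.
  by rewrite !mulf_neq0// ?intr_eq0// gt_eqF// pi_gt0.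
apply: complexP => /=.
- by rewrite Rintegral_cos_lin// sin_2pi_int mul0r.
- by rewrite Rintegral_sin_lin// cos_2pi_int subrr mul0r.
Qed.

Lemma inner_expo k l : inner (@expo R k) (expo l) = (k == l)%:R.
Proof.
rewrite -subr_eq0 -cintegral_expo; apply: eq_cintegral => t _.
by rewrite expoD expoN.
Qed.

Lemma L2M_expo k f : L2 f -> L2 (fun t => expo k t * f t).
Proof. exact/L2_Linf/Linf_expo. Qed.

Lemma inner_expoM k f g : inner (fun t => expo k t * f t) (fun t => expo k t * g t) = inner f g.
Proof.
apply: eq_cintegral => t _; rewrite cconjM mulrACA mulconj sqmod_expo.
by rewrite mul1r.
Qed.

Lemma inner_expo_shift k f g :
  inner (fun t => expo k t * f t) g = inner f (fun t => expo (- k) t * g t).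
Proof.
apply: eq_cintegral => t _; rewrite expoN cconjM cconjK; ring.
Qed.

Lemma sqnorm2_expoM k f : sqnorm2 (fun t => expo k t * f t) = sqnorm2 f.
Proof. by rewrite /sqnorm2 inner_expoM. Qed.

(** Generation from exponentials, instead of a list of coefficients, lets linear properties be
    proved by induction. *)
Inductive trigpoly : (R -> R[i]) -> Prop :=
| trigpoly_expo k : trigpoly (expo k)
| trigpolyD p q : trigpoly p -> trigpoly q -> trigpoly (fun t => p t + q t)
| trigpolyZ (c : R[i]) p : trigpoly p -> trigpoly (fun t => c * p t).

Lemma trigpolyM p q : trigpoly p -> trigpoly q -> trigpoly (fun t => p t * q t).
Proof.
elim=> [k|p1 p2 _ IH1 _ IH2|c p1 _ IH1] hq.
- elim: hq => [l|q1 q2 _ IH1 _ IH2|c q1 _ IH1].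
  + rewrite (_ : (fun t => _) = expo (k + l)); first exact: trigpoly_expo.
    by apply/funext => t; rewrite expoD.
  + under eq_fun do rewrite mulrDr; exact: trigpolyD.
  + under eq_fun do rewrite mulrCA; exact: trigpolyZ.
- under eq_fun do rewrite mulrDl.
  exact: trigpolyD (IH1 hq) (IH2 hq).
- under eq_fun do rewrite -mulrA; exact: trigpolyZ (IH1 hq).
Qed.

Lemma trigpoly_cst (c : R[i]) : trigpoly (fun=> c).
Proof.
rewrite (_ : (fun=> c) = fun t => c * expo 0 t); first exact/trigpolyZ/trigpoly_expo.
by apply/funext => t; rewrite expo0 mulr1.
Qed.

Lemma trigpolyX n p : trigpoly p -> trigpoly (fun t => p t ^+ n).
Proof.
move=> hp; elim: n => [|n IH].
  by under eq_fun do rewrite expr0; exact: trigpoly_cst.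
by under eq_fun do rewrite exprS; exact: trigpolyM.
Qed.

Lemma Linf_trigpoly p : trigpoly p -> Linf p.
Proof.
elim=> [k|p1 p2 _ [m1 [M1 h1]] _ [m2 [M2 h2]]|c p1 _ [m1 [M1 h1]]].
- exact: Linf_expo.
- split; first exact: cmeasurableD.
  exists (2 * M1 + 2 * M2); apply: ae_T_imp (ae_T_and h1 h2) => t _ [a b].
  by apply: le_trans (sqmodD_le _ _) _; apply: lerD; rewrite ler_pM2l.
- split; first by apply: cmeasurableM => //; exact: cmeasurable_cst.
  exists (sqmod c * M1); apply: ae_T_imp h1 => t _ h.
  by rewrite sqmodM; apply: ler_wpM2l => //; exact: sqmod_ge0.
Qed.

End Fourier.

(** * Polynomials on [0, 1] converging to the indicator of k x < 1 *)

Section Threshold.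
Variable R : realType.
Implicit Types (x y : R).

Lemma bernoulli_ge n x : 0 <= x -> 1 + n%:R * x <= (1 + x) ^+ n.
Proof.
move=> x0; elim: n => [|n IH]; first by rewrite mul0r addr0 expr0.
rewrite exprS -natr1 mulrDl mul1r.
have x1 : 0 <= 1 + x by rewrite addr_ge0.
apply: le_trans (ler_wpM2l x1 IH).
have n0 : 0 <= n%:R :> R by [].
by have := mulr_ge0 n0 (sqr_ge0 x); nra.
Qed.

Lemma bernoulli_le n x : 0 <= x <= 1 -> 1 - n%:R * x <= (1 - x) ^+ n.
Proof.
move=> /andP[x0 x1]; elim: n => [|n IH]; first by rewrite mul0r subr0 expr0.
rewrite exprS -natr1 mulrDl mul1r.
have x1' : 0 <= 1 - x by rewrite subr_ge0.
apply: le_trans (ler_wpM2l x1' IH).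
have n0 : 0 <= n%:R :> R by [].
by have := mulr_ge0 n0 (sqr_ge0 x); nra.
Qed.

Lemma cvg_expr0 y : 0 <= y < 1 -> y ^+ n @[n --> \oo] --> (0 : R).
Proof. by move=> /andP[y0 y1]; apply: cvg_expr; rewrite ger0_norm. Qed.

(** For z = sqrt y, Bernoulli gives n z^n <= 1 / (1/z - 1); hence n y^n = (n z^n) z^n is at most a
    constant times z^n. *)
Lemma cvg_natr_expr0 y : 0 <= y < 1 -> n%:R * y ^+ n @[n --> \oo] --> (0 : R).
Proof.
move=> /andP[]; rewrite le_eqVlt => /predU1P[<- _|y0 y1].
  apply: cvg_near_cst; exists 1%N => // -[|n]//= _.
  by rewrite exprS mul0r mulr0.
pose z := Num.sqrt y.
have z0 : 0 < z by rewrite sqrtr_gt0.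
have z1 : z < 1 by rewrite -sqrtr1 ltr_sqrt.
have zz : y = z ^+ 2 by rewrite sqr_sqrtr// ltW.
pose d := z^-1 - 1.
have d0 : 0 < d by rewrite subr_gt0 invf_gt1.
apply: (@squeeze_cvgr _ _ _ _ (fun=> 0) (fun n => d^-1 * z ^+ n)).
- near=> n; apply/andP; split; first by rewrite mulr_ge0// exprn_ge0// ltW.
  rewrite zz -exprM mulnC exprM expr2 mulrA; apply: ler_wpM2r; first by rewrite exprn_ge0// ltW.
  have := bernoulli_ge n (ltW d0).
  have -> : 1 + d = z^-1 by rewrite /d; ring.
  have zn : 0 < z ^+ n by rewrite exprn_gt0.
  move=> /(ler_wpM2r (ltW zn)); rewrite -exprMn mulVf ?gt_eqF// expr1n => H.
  rewrite -div1r ler_pdivlMr//; move: zn H; set q := z ^+ n; nra.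
- exact: cvg_cst.
- rewrite -[X in _ --> X](mulr0 d^-1); apply: cvgM; first exact: cvg_cst.
  by apply: cvg_expr0; rewrite ltW.
Unshelve. all: by end_near.
Qed.

(* The extra factor [n] in the exponent makes the limit [0] also at [k x = 1]. *)
Definition threshold (k n : nat) (x : R) : R := (1 - x ^+ n) ^+ (n * k ^ n).

Lemma threshold_itv k n x : 0 <= x <= 1 -> 0 <= threshold k n x <= 1.
Proof.
move=> /andP[x0 x1]; have x1' : 0 <= 1 - x ^+ n by rewrite subr_ge0 exprn_ile1.
by rewrite exprn_ge0//= exprn_ile1// gerBl exprn_ge0.
Qed.

(** Let N = n k^n, so that N x^n = n (k x)^n. If k x < 1, Bernoulli bounds the power below by 1 - n
    (k x)^n. If k x >= 1, then (1 - x^n)^N (1 + x^n)^N <= 1 while (1 + x^n)^N >= n + 1. *)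
Lemma cvg_threshold k x : 0 <= x <= 1 ->
  threshold k n x @[n --> \oo] --> ((k%:R * x < 1)%R%:R : R).
Proof.
move=> /andP[x0 x1]; have x01 : 0 <= x <= 1 by rewrite x0.
have xn n : 0 <= x ^+ n <= 1 by rewrite exprn_ge0//= exprn_ile1.
have kx0 : 0 <= k%:R * x by rewrite mulr_ge0.
have e n : (n * k ^ n)%:R * x ^+ n = n%:R * (k%:R * x) ^+ n.
  by rewrite natrM natrX exprMn mulrA.
case: ltP => kx /=.
- apply: (@squeeze_cvgr _ _ _ _ (fun n => 1 - n%:R * (k%:R * x) ^+ n) (fun=> 1)).
  + near=> n; have /andP[_ ->] := threshold_itv k n x01.
    by rewrite andbT -e; exact: bernoulli_le.
  + rewrite -[X in _ --> X](subr0 1); apply: cvgB; first exact: cvg_cst.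
    by apply: cvg_natr_expr0; rewrite kx0.
  + exact: cvg_cst.
- apply: (@squeeze_cvgr _ _ _ _ (fun=> 0) (fun n => n.+1%:R^-1)).
  + near=> n; have /andP[-> _] := threshold_itv k n x01; rewrite andTb.
    have /andP[a0 a1] := xn n.
    have H := bernoulli_ge (n * k ^ n) a0.
    have N1 : n.+1%:R <= (1 + x ^+ n) ^+ (n * k ^ n).
      apply: le_trans H; rewrite e -natr1 addrC lerD2l.
      by rewrite -[leLHS]mulr1 ler_wpM2l// exprn_ege1.
    rewrite -[leRHS]mul1r ler_pdivlMr ?ltr0n//.
    apply: le_trans (ler_wpM2l _ N1) _.
      by have /andP[] := threshold_itv k n x01.
    rewrite /threshold -exprMn exprn_ile1//; nra.
  + exact: cvg_cst.
  + exact: cvg_harmonic.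
Unshelve. all: by end_near.
Qed.

End Threshold.

(** * From positivity against trigonometric polynomials to positivity on arcs *)

Section Positivity.
Variable R : realType.
Local Notation mu := (@lebesgue_measure R).
Local Notation D := (@Tpar R).

(** This is sin^2 (pi (t - c)), written with the double angle to exhibit a trigonometric polynomial
    of degree one. *)
Definition arc_bump (c t : R) : R := (1 - cos (2 * pi * (t - c))) / 2.

Lemma arc_bump_itv c t : 0 <= arc_bump c t <= 1.
Proof.
rewrite /arc_bump; have := cos_le1 (2 * pi * (t - c)); have := cos_geN1 (2 * pi * (t - c)).
by move=> a b; apply/andP; split; lra.
Qed.

Lemma trigpoly_arc_bump c : trigpoly (fun t => (arc_bump c t)%:C%C).
Proof.
(* Euler's formula for the cosine: the coefficients of z and 1/z are -1/4 times the phases of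
   modulus one coming from [c]. *)
have := trigpolyD (trigpoly_cst (2^-1)%:C%C)
  (trigpolyZ (- (4^-1)%:C%C) (trigpolyD (trigpolyZ (expo (-1) c) (@trigpoly_expo R 1))
     (trigpolyZ (expo 1 c) (@trigpoly_expo R (-1))))).
congr trigpoly; apply/funext => t; rewrite !expoN; apply: complexP.
- rewrite !ReImE /= /arc_bump !mulr1 mulrBr cosB; by field.
- by rewrite !ReImE /=; ring.
Qed.

Lemma trigpoly_threshold c k n : trigpoly (fun t => (threshold k n (arc_bump c t))%:C%C).
Proof.
have := trigpolyX (n * k ^ n) (trigpolyD (trigpoly_cst 1)
  (trigpolyZ (-1) (trigpolyX n (trigpoly_arc_bump c)))).
congr trigpoly; apply/funext => t.
by rewrite /threshold rmorphXn rmorphB rmorph1 rmorphXn mulN1r.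
Qed.

Lemma sqmod_real (x : R) : sqmod x%:C%C = x ^+ 2.
Proof. by rewrite /sqmod/= expr0n addr0. Qed.

Lemma measurable_arc_bump c : measurable_fun D (arc_bump c).
Proof.
apply: measurable_funTS; apply: continuous_measurable_fun => t.
rewrite /arc_bump; apply: cvgM; last exact: cvg_cst.
apply: cvgB; first exact: cvg_cst.
apply: continuous_comp; last exact: continuous_cos.
apply: cvgM; first exact: cvg_cst.
by apply: cvgB; [exact: cvg_id|exact: cvg_cst].
Qed.

Lemma measurable_threshold c k n : measurable_fun D (fun t => threshold k n (arc_bump c t)).
Proof.
apply: measurable_funX; apply: measurable_funB; first exact: measurable_cst.
by apply: measurable_funX; exact: measurable_arc_bump.
Qed.

Variable h : R -> R.
Hypothesis ih : mu.-integrable D (EFin \o h).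
Hypothesis h_ge0 : forall p, trigpoly p -> 0 <= Rintegral mu D (fun t => h t * sqmod (p t)).

Let mh : measurable_fun D h.
Proof. by have /integrableP[/measurable_EFinP] := ih. Qed.

(** The integrals of [h] against the squared threshold polynomials are nonnegative, and dominated
    convergence with majorant |h| passes to the indicator. *)
Lemma Rintegral_sublevel_ge0 c k :
  (0 <= \int[mu]_(t in D) (h t * (k%:R * arc_bump c t < 1)%R%:R)%:E)%E.
Proof.
pose f n t := (h t * threshold k n (arc_bump c t) ^+ 2)%:E.
have mf n : measurable_fun (D : set (measurableTypeR R)) (f n).
  apply: measurable_EFin_Tpar; apply: measurable_funM => //.
  by apply: measurable_funX; exact: measurable_threshold.
pose g := EFin \o (fun t => `|h t|).
have fh n (t : measurableTypeR R) : D t -> (`|f n t| <= g t)%E.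
  move=> _; rewrite lee_fin normrM normrX; apply: ler_piMr => //.
  have /andP[a b] := threshold_itv k n (arc_bump_itv c t).
  by rewrite (ger0_norm a) exprn_ile1.
have fcvg (t : measurableTypeR R) : D t ->
    f ^~ t @ \oo --> (h t * (k%:R * arc_bump c t < 1)%R%:R)%:E.
  move=> _; apply: cvg_EFin; first by apply: nearW.
  apply: cvgM; first exact: cvg_cst.
  (* An indicator is its own square, which matches the square of the threshold polynomial. *)
  have -> : (k%:R * arc_bump c t < 1)%R%:R = (k%:R * arc_bump c t < 1)%R%:R ^+ 2 :> R.
    by case: (_ < _); rewrite ?expr1n ?expr0n.
  by rewrite expr2; apply: cvgM; apply: cvg_threshold; exact: arc_bump_itv.
have ig : mu.-integrable D g by exact: integrable_norm ih.
pose l t := (h t * (k%:R * arc_bump c t < 1)%R%:R)%:E.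
have ml : measurable_fun (D : set (measurableTypeR R)) l :=
  emeasurable_fun_cvg (f : nat -> measurableTypeR R -> _) l mf fcvg.
have [_ _ lim] := @dominated_convergence _ _ R mu D (@measurable_Tpar R) f l g mf
  ml (aeW _ fcvg) ig (aeW _ (fun t n => fh n t)).
rewrite -(cvg_lim _ lim)//; apply: lime_ge; first by apply/cvg_ex; eexists; exact: lim.
apply: nearW => n.
have ifn : mu.-integrable D (f n).
  apply: (le_integrable (@measurable_Tpar R) (mf n) _ ig) => t Dt.
  by apply: le_trans (fh n t Dt) _; rewrite lee_fin normr_id.
rewrite /= -(fineK (integrable_fin_num (@measurable_Tpar R) ifn)) lee_fin.
have := h_ge0 (trigpoly_threshold c k n).
by under eq_Rintegral do rewrite sqmod_real.
Qed.

(** The r in (0, 1/2] with sin^2 (pi r) = 1 / (n + 1), that is, the half-length of the arc where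
    [arc_bump] is below 1 / (n + 1). *)
Definition arc_radius (n : nat) : R := acos (1 - 2 / n.+1%:R) / (2 * pi).

Let twopi_gt0 : 0 < 2 * pi :> R. Proof. by rewrite mulr_gt0// pi_gt0. Qed.

Let arc_arg n : -1 <= (1 - 2 / n.+1%:R : R) < 1.
Proof.
have n0 : 0 < n.+1%:R^-1 :> R by rewrite invr_gt0.
have n1 : n.+1%:R^-1 <= 1 :> R by rewrite invf_le1// ler1n.
by move: n0 n1; move: (n.+1%:R^-1) => x a b; apply/andP; split; lra.
Qed.

Lemma arc_radius_gt0 n : 0 < arc_radius n.
Proof. by rewrite divr_gt0// acos_gt0// arc_arg. Qed.

Let arc_argW n : -1 <= (1 - 2 / n.+1%:R : R) <= 1.
Proof. by have /andP[-> /ltW] := arc_arg n. Qed.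

Lemma cos_arc_radius n : cos (2 * pi * arc_radius n) = 1 - 2 / n.+1%:R.
Proof.
rewrite /arc_radius mulrC divfK ?gt_eqF// acosK// in_itv/=.
exact: arc_argW.
Qed.

Lemma arc_radius_pi n : 0 <= 2 * pi * arc_radius n <= pi.
Proof.
rewrite /arc_radius mulrC divfK ?gt_eqF//.
by rewrite acos_ge0 ?acos_lepi// arc_argW.
Qed.

Lemma cvg_arc_radius : arc_radius n @[n --> \oo] --> (0 : R).
Proof.
(* The cap 1/2 keeps 2 pi d inside [0, pi], where the cosine is decreasing. *)
apply/cvgr0Pnorm_lt => e e0; pose d : R := Num.min e 2^-1.
have d0 : 0 < d by rewrite /d lt_min e0/= invr_gt0.
have d2 : d <= 2^-1 by rewrite ge_min lexx orbT.
have dpi : 0 <= 2 * pi * d <= pi.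
  apply/andP; split; first by rewrite mulr_ge0 ?(ltW twopi_gt0) ?(ltW d0).
  by rewrite mulrAC ger_pMl ?pi_gt0//; lra.
have cd : cos (2 * pi * d) < 1.
  rewrite -[X in _ < X](@cos0 R) ltr_cos ?in_itv/= ?lexx ?pi_ge0//.
  by rewrite mulr_gt0.
have e' : 0 < (1 - cos (2 * pi * d)) / 4 by rewrite divr_gt0// subr_gt0.
have [N hN] := small_inv e'.
exists N => // n /= Nn; rewrite gtr0_norm ?arc_radius_gt0//.
apply: (@lt_le_trans _ _ d); last by rewrite ge_min lexx.
rewrite -(ltr_pM2l twopi_gt0) -ltr_cos ?in_itv//=; last exact: arc_radius_pi.
rewrite cos_arc_radius; have := hN n Nn.
move: cd; move: (n.+1%:R^-1) (cos _) => x y; lra.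
Qed.

(** The sublevel set is an arc of the circle around [c]. The bound on the radius keeps this arc from
    crossing the point 0 = 1, so in the parameter it is an ordinary ball. *)
Lemma arc_bump_sublevel c t n : 0 < c < 1 -> arc_radius n < Num.min c (1 - c) -> D t ->
  (n.+1%:R * arc_bump c t < 1) = (`|c - t| < arc_radius n).
Proof.
move=> /andP[c0 c1]; rewrite lt_min => /andP[rc rc1].
rewrite /Tpar/= in_itv/= => /andP[t0 t1].
have n0 : 0 < n.+1%:R :> R by [].
have -> : (n.+1%:R * arc_bump c t < 1) = (cos (2 * pi * arc_radius n) < cos (2 * pi * (t - c))).
  rewrite cos_arc_radius mulrC -ltr_pdivlMr// /arc_bump.
  by move: (n.+1%:R^-1) (cos _) => x y; apply/idP/idP; lra.
rewrite -[cos (_ * (t - c))]cos_norm normrM (gtr0_norm twopi_gt0) distrC.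
set s := `|c - t|.
have s0 : 0 <= s by exact: normr_ge0.
have s1 : s <= Num.max c (1 - c).
  rewrite /s le_max; have [ct|ct] := leP c t.
    by rewrite distrC ger0_norm ?subr_ge0// lerD2r t1 orbT.
  by rewrite gtr0_norm ?subr_gt0// gerBl t0.
have pi0 := @pi_gt0 R.
have /andP[r0 r1] := arc_radius_pi n.
have [s2|s2] := leP s 2^-1.
  rewrite ltr_cos ?ltr_pM2l// in_itv/= ?r0 ?r1// mulr_ge0 ?(ltW twopi_gt0)//=.
  by rewrite mulrAC ger_pMl//; lra.
(* Beyond half a turn the distance on the circle is 1 - s, still larger than the radius, so both
   sides are false. *)
have -> : cos (2 * pi * s) = cos (2 * pi * (1 - s)).
  rewrite -[RHS]cosN -[RHS](@cosD2pi R); congr cos; rewrite -mulr_natr; ring.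
have r2 : arc_radius n <= 2^-1.
  by rewrite -(ler_pM2l twopi_gt0) [leRHS]mulrAC mulfV ?mul1r// pnatr_eq0.
have rs : arc_radius n < 1 - s.
  by move: s1; rewrite le_max => /orP[]; lra.
rewrite [RHS]lt_gtF; last by lra.
have inr : 2 * pi * arc_radius n \in `[0, pi] by rewrite in_itv/= r0.
have ins : 2 * pi * (1 - s) \in `[0, pi].
  rewrite in_itv/= mulr_ge0 ?(ltW twopi_gt0)//=.
    by rewrite mulrAC ger_pMl//; lra.
  exact: le_trans (ltW (arc_radius_gt0 n)) (ltW rs).
by rewrite (ltr_cos ins inr) ltr_pM2l// lt_gtF.
Qed.

End Positivity.

(** * Almost everywhere positivity and completeness of the Fourier basis *)

Section Density.
Variable R : realType.
Implicit Types (f g h p q : R -> R[i]).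
Local Notation Re := (@complex.Re R).
Local Notation mu := (@lebesgue_measure R).
Local Notation D := (@Tpar R).

Lemma ae_T_neq (x : R) : ae_T (fun t => t != x).
Proof.
exists [set x]; split; first exact: measurable_set1.
  exact: lebesgue_measure_set1.
move=> t /= H; apply: contrapT => tx; apply: H => _; exact/eqP.
Qed.

Lemma ae_ge0_of_trigpoly (h : R -> R) : mu.-integrable D (EFin \o h) ->
  (forall p, trigpoly p -> 0 <= Rintegral mu D (fun t => h t * sqmod (p t))) ->
  ae_T (fun t => 0 <= h t).
Proof.
move=> ih h_ge0.
have loc : locally_integrable [set: R] (h \_ D).
  exact: integrable_locally_restrict (@measurable_Tpar R) ih.
pose E (x : R) n : set R := ball x (arc_radius R n).
have hE x : nicely_shrinking x (E x).
  split; first by move=> n; exact: measurable_ball.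
  exists (1, fun n => PosNum (arc_radius_gt0 R n)); split => //=.
  - exact: cvg_arc_radius.
  - by move=> n; exact: subset_refl.
  - by move=> n; rewrite mul1e.
have leb : ae_T (fun t => lebesgue_pt (h \_ D) t).
  have [N [mN N0 sub]] := lebesgue_differentiation loc.
  by exists N; split => // t /= H; apply: sub => /= K; apply: H => _; exact: K.
(* Dropping the endpoints 0 and 1 makes [t] interior, so [arc_bump_sublevel] applies to all
   sufficiently small arcs. *)
apply: ae_T_imp (ae_T_and leb (ae_T_and (ae_T_neq 0) (ae_T_neq 1))) => t Dt [lt [t0 t1]].
have t01 : 0 < t < 1.
  by move: Dt; rewrite /Tpar/= in_itv/= => /andP[a b]; rewrite !lt_neqAle eq_sym t0 a t1 b.
have lim := nice_lebesgue_differentiation hE loc lt.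
have hD : (h \_ D) t = h t by rewrite patchE mem_set.
rewrite -lee_fin -hD -(cvg_lim _ lim)//; apply: lime_ge.
  by apply/cvg_ex; eexists; exact: lim.
have m0 : 0 < Num.min t (1 - t) by move: t01 => /andP[a b]; rewrite lt_min a subr_gt0.
have /cvgr0Pnorm_lt/(_ _ m0)[N _ hN] := @cvg_arc_radius R.
exists N => // n /hN /=; rewrite gtr0_norm ?arc_radius_gt0// => rn.
apply: mule_ge0; first by rewrite inve_ge0.
rewrite [leRHS](_ : _ = (\int[mu]_(y in D) (h y * (n.+1%:R * arc_bump t y < 1)%R%:R)%:E)%E).
  exact: Rintegral_sublevel_ge0.
transitivity (\int[mu]_(y in E t n) ((EFin \o h) \_ D) y)%E.
  by apply: eq_integral => y _; rewrite restrict_EFin.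
rewrite -integral_mkcondr setIC integral_mkcondr.
apply: eq_integral => y; rewrite inE => Dy.
rewrite patchE (arc_bump_sublevel t01 rn Dy).
have -> : (y \in E t n) = (`|t - y| < arc_radius R n).
  by apply/idP/idP => [/set_mem|H]; last exact/mem_set.
by case: ifP => _ /=; rewrite (mulr1, mulr0).
Qed.

Lemma L2_trigpoly p : trigpoly p -> L2 p.
Proof.
move=> hp; rewrite (_ : p = fun t => p t * 1); last by apply/funext => t; rewrite mulr1.
by apply: L2_Linf; [exact: Linf_trigpoly|exact: L2_cst].
Qed.

(** Since |p|^2 is a trigonometric polynomial, Re (c f) has zero integral against it for every
    constant c. The positivity criterion for c = 1, -1, i, -i forces both parts of [f] to vanish. *)
Lemma fourier_eq0 f : L2 f -> (forall k : int, inner f (expo k) = 0) ->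
  ae_eqT f (fun=> 0).
Proof.
move=> hf f0.
have fp p : trigpoly p -> inner f p = 0.
  elim=> [k|p1 p2 h1 e1 h2 e2|c p1 h1 e1]; first exact: f0.
  - by rewrite innerDr//; try exact: L2_trigpoly; rewrite e1 e2 addr0.
  - by rewrite innerZr//; try exact: L2_trigpoly; rewrite e1 mulr0.
have trigpoly_conj p : trigpoly p -> trigpoly (fun t => (p t)^*).
  elim=> [k|p1 p2 _ h1 _ h2|c p1 _ h1].
  - rewrite (_ : (fun t => _) = expo (- k)); first exact: trigpoly_expo.
    by apply/funext => t; rewrite expoN.
  - under eq_fun do rewrite cconjD; exact: trigpolyD.
  - under eq_fun do rewrite cconjM; exact: trigpolyZ.
have key (c : R[i]) : ae_T (fun t => 0 <= Re (c * f t)).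
  have hcf : L2 (fun t => c * f t) by exact: L2Z.
  have icf : mu.-integrable D (EFin \o (fun t => Re (c * f t))).
    have := (L2_cintegrable hcf (@L2_cst R 1)).1.
    congr (mu.-integrable _ _); apply/funext => t /=.
    by rewrite conjC1 mulr1.
  apply: ae_ge0_of_trigpoly => // p hp.
  have hpp : trigpoly (fun t => p t * (p t)^*) by exact/trigpolyM/trigpoly_conj.
  have : Re (inner (fun t => c * f t) (fun t => p t * (p t)^*)) = 0.
    by rewrite innerZl//; [rewrite fp// mulr0|exact: L2_trigpoly].
  move=> h0; rewrite [leRHS](_ : _ = 0)// -[RHS]h0.
  by apply: eq_Rintegral => t _; rewrite mulconj !ReImE/=; ring.
apply: ae_T_imp (ae_T_and (ae_T_and (key 1) (key (-1)))
  (ae_T_and (key 'i%C) (key (- 'i%C)))) => t _ [[a b] [c d]].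
move: a b c d; rewrite !ReImE/= => a b c d.
by apply: complexP => /=; lra.
Qed.

End Density.

(** * The Hardy space and Toeplitz operators *)

Section HardySpace.
Variable R : realType.
Implicit Types (f g h p q a : R -> R[i]).

Definition neg_expo f := exists2 n : nat, (0 < n)%N & f = expo (- n%:Z).

Lemma L2_neg_expo f : neg_expo f -> L2 f.
Proof. by case=> n _ ->; exact: L2_expo. Qed.

Lemma H2_annihilator : @H2 R = annihilator neg_expo.
Proof.
apply/funext => f; apply/propext; split=> -[Lf h]; split=> //.
- by move=> _ [n n0 ->]; exact: h.
- by move=> n n0; apply: h; exists n.
Qed.

Lemma H2_L2 f : H2 f -> L2 f. Proof. by case. Qed.

Lemma H2_lin (c : R[i]) f g : H2 f -> H2 g -> H2 (fun t => f t + c * g t).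
Proof. by rewrite H2_annihilator; exact/annihilator_lin/L2_neg_expo. Qed.

Lemma H2D f g : H2 f -> H2 g -> H2 (fun t => f t + g t).
Proof.
by move=> hf hg; have := H2_lin 1 hf hg; under eq_fun do rewrite mul1r.
Qed.

Lemma H2B f g : H2 f -> H2 g -> H2 (fun t => f t - g t).
Proof.
by move=> hf hg; have := H2_lin (-1) hf hg; under eq_fun do rewrite mulN1r.
Qed.

Lemma H2_0 : H2 (fun=> 0 : R[i]).
Proof.
split; first exact: L2_cst.
by move=> n _; exact: inner0l.
Qed.

Lemma H2Z (c : R[i]) f : H2 f -> H2 (fun t => c * f t).
Proof.
by move=> hf; have := H2_lin c H2_0 hf; under eq_fun do rewrite add0r.
Qed.

Lemma H2_lim u f : (forall n : nat, H2 (u n)) -> L2 f -> L2lim u f -> H2 f.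
Proof. by rewrite H2_annihilator; exact/annihilator_lim/L2_neg_expo. Qed.

Lemma H2_proj h : L2 h -> exists g, is_proj (@H2 R) h g.
Proof. by rewrite H2_annihilator; exact/annihilator_proj/L2_neg_expo. Qed.

Lemma H2_expo (n : nat) : H2 (@expo R n%:Z).
Proof.
split; first exact: L2_expo.
move=> m m0; rewrite inner_expo; case: eqP => // H; exfalso.
by move: H m0; case: m n => [|m] [|n].
Qed.

(** The projection of [g] onto H^2 has no Fourier coefficient left: the nonnegative ones agree with
    those of [g], and the negative ones vanish on H^2. So it is zero, and [g] is orthogonal to
    H^2. *)
Lemma orthogonal_H2 g : L2 g -> (forall n : nat, inner g (expo n%:Z) = 0) ->
  forall h, H2 h -> inner g h = 0.
Proof.
move=> Lg g0 h Hh.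
have [d [Hd gd]] := H2_proj Lg.
have Ld := H2_L2 Hd; have Lh := H2_L2 Hh.
have dE f : H2 f -> inner g f = inner d f.
  move=> Hf; have := gd f Hf; rewrite innerBl//; last exact: H2_L2.
  by move/eqP; rewrite subr_eq0 => /eqP.
rewrite dE//.
have d0 : ae_eqT d (fun=> 0).
  apply: fourier_eq0 => // -[n|n].
    by rewrite -dE ?g0//; exact: H2_expo.
  by rewrite NegzE; apply: Hd.2.
have L0 : L2 (fun=> 0 : R[i]) by exact: L2_cst.
rewrite (inner_ae Ld L0 Lh Lh d0 _); last exact: ae_T_all.
exact: inner0l.
Qed.

(** Density of analytic polynomials, in a form suited to closed conditions: [f] minus its projection
    onto [S] lies in H^2 and is orthogonal to every z^n, hence is zero. *)
Lemma H2_closed_subspace (S : (R -> R[i]) -> Prop) :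
  (forall f, S f -> H2 f) -> (forall n : nat, S (expo n%:Z)) ->
  (forall (c : R[i]) f g, S f -> S g -> S (fun t => f t + c * g t)) ->
  (forall u f, (forall n : nat, S (u n)) -> H2 f -> L2lim u f -> S f) ->
  forall f, H2 f -> exists2 g, S g & ae_eqT f g.
Proof.
move=> SH Se Slin Slim f Hf.
have S0 : S (fun=> 0).
  have := Slin (-1) _ _ (Se 0%N) (Se 0%N).
  by congr S; apply/funext => t; rewrite mulN1r subrr.
have Slim' u f' : (forall n : nat, S (u n)) -> L2 f' -> L2lim u f' -> S f'.
  by move=> Su Lf uf; apply: (Slim u) => //; apply: H2_lim uf => // n; exact/SH.
have [g [Sg fg]] := projection (fun k Sk => H2_L2 (SH k Sk)) S0 Slin Slim' (H2_L2 Hf).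
exists g => //; have Hg := SH g Sg.
have Hd := H2B Hf Hg.
have : ae_eqT (fun t => f t - g t) (fun=> 0).
  apply: fourier_eq0; first exact: H2_L2.
  case=> n; first exact: fg.
  by rewrite NegzE; apply: Hd.2.
by apply: ae_T_imp => t _ /eqP; rewrite subr_eq0 => /eqP.
Qed.

Section BoundedOperator.
Variable A : (R -> R[i]) -> (R -> R[i]).
Hypothesis hA : bounded_linear_H2 A.

Lemma op_H2 f : H2 f -> H2 (A f).
Proof. by case: hA => H _ _ _; exact: H. Qed.

Lemma opD f g : H2 f -> H2 g -> ae_eqT (A (fun t => f t + g t)) (fun t => A f t + A g t).
Proof. by case: hA => _ H _ _; exact: H. Qed.

Lemma opZ (c : R[i]) f : H2 f -> ae_eqT (A (fun t => c * f t)) (fun t => c * A f t).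
Proof. by case: hA => _ _ H _; exact: H. Qed.

Lemma op_lin (c : R[i]) f g : H2 f -> H2 g ->
  ae_eqT (A (fun t => f t + c * g t)) (fun t => A f t + c * A g t).
Proof.
move=> hf hg; apply: ae_eqT_trans (opD hf (H2Z c hg)) _.
by apply: ae_T_imp (opZ c hg) => t _ ->.
Qed.

(** [A] is linear only up to almost everywhere equality. Stating the bound for differences gives
    both compatibility with that equality and continuity. *)
Lemma op_bound : exists2 M, 0 <= M & forall f g, H2 f -> H2 g ->
  sqnorm2 (fun t => A f t - A g t) <= M * sqnorm2 (fun t => f t - g t).
Proof.
case: (hA) => _ _ _ [M hM]; exists `|M| => // f g hf hg.
have Hd : H2 (fun t => f t + (-1) * g t) by exact: H2_lin.
have -> : sqnorm2 (fun t => A f t - A g t) = sqnorm2 (A (fun t => f t + (-1) * g t)).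
  apply: sqnorm2_ae; [apply: L2B; exact/H2_L2/op_H2|exact/H2_L2/op_H2|].
  by apply: ae_T_imp (op_lin (-1) hf hg) => t _ ->; rewrite mulN1r.
apply: le_trans (hM _ Hd) _.
under eq_fun do rewrite mulN1r.
by apply: ler_wpM2r; [exact: sqnorm2_ge0|exact: ler_norm].
Qed.

Lemma op_ae f g : H2 f -> H2 g -> ae_eqT f g -> ae_eqT (A f) (A g).
Proof.
move=> hf hg fg; have [M M0 hM] := op_bound.
have LA : L2 (fun t => A f t - A g t) by apply: L2B; exact/H2_L2/op_H2.
have : sqnorm2 (fun t => A f t - A g t) = 0.
  apply/eqP; rewrite eq_le sqnorm2_ge0 andbT; apply: le_trans (hM f g hf hg) _.
  rewrite (@sqnorm2_ae R _ (fun=> 0)).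
  - by rewrite /sqnorm2 inner0l mulr0.
  - by apply: L2B; exact: H2_L2.
  - exact: L2_cst.
  - by apply: ae_T_imp fg => t _ ->; rewrite subrr.
move/(sqnorm2_eq0 LA); apply: ae_T_imp => t _ /eqP.
by rewrite subr_eq0 => /eqP.
Qed.

Lemma op_lim u f : (forall n : nat, H2 (u n)) -> H2 f -> L2lim u f ->
  L2lim (fun n => A (u n)) (A f).
Proof.
move=> hu hf uf e e0; have [M M0 hM] := op_bound.
have e' : 0 < e / (M + 1) by rewrite divr_gt0// ltr_wpDl.
have [N hN] := uf _ e'; exists N => n /hN; rewrite ler_pdivlMr ?ltr_wpDl// => H.
apply: le_trans (hM _ _ (hu n) hf) (le_trans _ H).
by rewrite mulrC ler_wpM2l ?sqnorm2_ge0// lerDl.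
Qed.

End BoundedOperator.
End HardySpace.

(** * L^2 limits of differences and of bounded multiples *)

Section L2limFacts.
Variable R : realType.
Implicit Types (f g h : R -> R[i]).

Lemma L2limB u v f g : (forall n : nat, L2 (u n)) -> (forall n : nat, L2 (v n)) ->
  L2 f -> L2 g -> L2lim u f -> L2lim v g ->
  L2lim (fun n t => u n t - v n t) (fun t => f t - g t).
Proof.
move=> hu hv hf hg uf vg d d0; have d4 : 0 < d / 4 by rewrite divr_gt0.
have [N1 h1] := uf _ d4; have [N2 h2] := vg _ d4.
exists (maxn N1 N2) => n; rewrite geq_max => /andP[/h1 b1 /h2 b2].
have -> : (fun t => u n t - v n t - (f t - g t)) =
          (fun t => (u n t - f t) + (g t - v n t)).
  by apply/funext => t; ring.
have L1 := L2B (hu n) hf; have L2' := L2B hg (hv n).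
apply: le_trans (sqnorm2D_le L1 L2') _.
by rewrite [X in _ + 2 * X]sqnorm2N//; lra.
Qed.

Lemma L2lim_Linf f u g : Linf f -> (forall n : nat, L2 (u n)) -> L2 g -> L2lim u g ->
  L2lim (fun n t => f t * u n t) (fun t => f t * g t).
Proof.
move=> Lf hu hg ug d d0; have [mf [M hM]] := Lf.
have M1 : 0 < `|M| + 1 by rewrite ltr_wpDl.
have d' : 0 < d / (`|M| + 1) by rewrite divr_gt0.
have [N hN] := ug _ d'; exists N => n /hN; rewrite ler_pdivlMr// => H.
have Ld := L2B (hu n) hg.
apply: le_trans H; rewrite mulrC !sqnorm2E.
have i1 := L2_integrable Ld.
rewrite -(RintegralZl _ (@measurable_Tpar R) i1); apply: ae_le_Rintegral.
- by move=> t; exact: sqmod_ge0.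
- apply: measurable_sqmod; apply: cmeasurableB; apply: cmeasurableM => //.
  + by case: (hu n).
  + by case: hg.
- by move=> t; rewrite mulr_ge0 ?sqmod_ge0// ltW.
- exact: integrable_Zl.
- apply: ae_T_imp hM => t _ h; rewrite -mulrBr sqmodM; apply: ler_wpM2r.
    exact: sqmod_ge0.
  by apply: le_trans h _; apply: le_trans (ler_norm _) _; rewrite lerDl.
Qed.

End L2limFacts.

(** * The Brown-Halmos theorem *)

Section BrownHalmos.
Variable R : realType.
Implicit Types (f g h p q a : R -> R[i]).
Local Notation mu := (@lebesgue_measure R).
Local Notation D := (@Tpar R).

Variable A : (R -> R[i]) -> (R -> R[i]).
Hypothesis hA : bounded_linear_H2 A.
Hypothesis A_toeplitz : forall i j : nat,
  inner (A (expo i.+1%:Z)) (expo j.+1%:Z) = inner (A (expo i%:Z)) (expo j%:Z).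

Let e (n : nat) : R -> R[i] := expo n%:Z.

Let A_toeplitzD (m i j : nat) : inner (A (e (m + i))) (e (m + j)) = inner (A (e i)) (e j).
Proof. by elim: m => [//|m IH]; rewrite !addSn A_toeplitz. Qed.

Let L2A (n : nat) : L2 (A (e n)).
Proof. exact/H2_L2/(op_H2 hA)/H2_expo. Qed.

Let phi (n : nat) : R -> R[i] := fun t => expo (- n%:Z) t * A (e n) t.

Let L2phi n : L2 (phi n). Proof. exact: L2M_expo. Qed.

Let expo_cancel (k : int) (t : R) : expo k t * expo (- k) t = 1 :> R[i].
Proof. by rewrite -expoD subrr expo0. Qed.

Let sqnorm2_phi n : sqnorm2 (phi n) = sqnorm2 (A (e n)).
Proof. exact: sqnorm2_expoM. Qed.

Let inner_phi (n j : nat) : inner (fun t => expo n%:Z t * phi n t) (e j) = inner (A (e n)) (e j).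
Proof. by apply: eq_cintegral => t _; rewrite /phi mulrA expo_cancel mul1r. Qed.

(** Multiplication by z^n is isometric and sends phi_n to A z^n, an element of H^2. It thus suffices
    to test against z^j with j >= 0, where both terms equal <A z^n, z^j> by the Toeplitz relation
    shifted by m - n. *)
Let phi_orth m n : (n <= m)%N -> inner (fun t => phi m t - phi n t) (phi n) = 0.
Proof.
move=> nm; rewrite -(inner_expoM n%:Z).
have -> : (fun t => expo n%:Z t * phi n t) = A (e n).
  by apply/funext => t; rewrite /phi mulrA expo_cancel mul1r.
apply: orthogonal_H2; last exact/(op_H2 hA)/H2_expo.
  by apply: L2M_expo; exact: L2B.
move=> j; rewrite (_ : (fun t => _) =
  fun t => expo n%:Z t * phi m t - expo n%:Z t * phi n t); last first.
  by apply/funext => t; rewrite mulrBr.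
rewrite innerBl//; try exact: L2M_expo; last exact: L2_expo.
rewrite inner_phi inner_expo_shift -(A_toeplitzD (m - n)) subnK//.
rewrite -(inner_phi m) inner_expo_shift; apply/eqP; rewrite subr_eq0; apply/eqP.
apply: eq_cintegral => t _; congr (_ * _^*); rewrite -!expoD; congr expo.
by rewrite PoszD -subzn//; ring.
Qed.

Let phi_dist m n : (n <= m)%N ->
  sqnorm2 (fun t => phi m t - phi n t) = sqnorm2 (phi m) - sqnorm2 (phi n).
Proof.
move=> nm.
have {2}-> : phi m = fun t => (phi m t - phi n t) + phi n t.
  by apply/funext => t; rewrite subrK.
rewrite (sqnorm2D (L2B (L2phi m) (L2phi n)) (L2phi n)).
by rewrite phi_orth//= mulr0 addr0 addrK.
Qed.

(** By [phi_dist] the numbers |phi_n|^2 increase, and they are bounded because [A] is. Past an index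
    where they come within [d] of their supremum, squared distances are below [d]. *)
Let phi_lim : exists f, L2 f /\ L2lim phi f.
Proof.
apply: L2_complete => // d d0.
have [M hM] : exists M, forall n, sqnorm2 (phi n) <= M.
  case: (hA) => _ _ _ [M hM]; exists M => n; rewrite sqnorm2_phi.
  apply: le_trans (hM _ (H2_expo R n)) _.
  by rewrite /sqnorm2 inner_expo eqxx mulr1.
pose E : set R := range (fun n => sqnorm2 (phi n)).
have supE : has_sup E.
  split; first by exists (sqnorm2 (phi 0)), 0%N.
  by exists M => _ [n _ <-].
have [_ [N _ <-] hN] := sup_adherent d0 supE.
have le_sup n : sqnorm2 (phi n) <= sup E by apply: ub_le_sup; [case: supE|exists n].
exists N => m n Nm Nn.
wlog nm : m n Nm Nn / (n <= m)%N.
  move=> H; have [nm|/ltnW mn] := leqP n m; first exact: H.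
  by rewrite sqnorm2N//; exact: H.
rewrite phi_dist//; have := phi_dist Nn; have := sqnorm2_ge0 (fun t => phi n t - phi N t).
by have := le_sup m; move: hN; lra.
Qed.

Lemma toeplitz_symbol : exists f, Linf f /\
  forall i j : nat, inner (fun t => f t * e i t) (e j) = inner (A (e i)) (e j).
Proof.
have [f [Lf phif]] := phi_lim.
have [M0 hM0] : exists M, forall g, H2 g -> sqnorm2 (A g) <= M * sqnorm2 g by case: hA.
(* z^(-n) A (z^n p) --> f p in L^2; [A] is only controlled on [H2], hence the first clause. *)
pose good p := forall d, 0 < d -> exists N : nat, forall n, (N <= n)%N ->
  H2 (fun t => e n t * p t) /\
  sqnorm2 (fun t => expo (- n%:Z) t * A (fun t => e n t * p t) t - f t * p t) <= d.
have L2v p n : H2 (fun t => e n t * p t) ->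
    L2 (fun t => expo (- n%:Z) t * A (fun t => e n t * p t) t).
  by move=> h; apply/L2M_expo/H2_L2/(op_H2 hA).
have L2fp p : trigpoly p -> L2 (fun t => f t * p t).
  move=> hp; under eq_fun do rewrite mulrC.
  by apply: L2_Linf => //; exact: Linf_trigpoly.
have good_trigpoly p : trigpoly p -> good p.
  elim=> [k|p1 p2 h1 IH1 h2 IH2|c p1 h1 IH1] d d0.
  (* For p = z^k the approximant is z^k phi_(n+k). Taking n >= N + |k| makes n + k a natural number
     that is at least N. *)
  - have [N hN] := phif d d0; exists (N + `|k|)%N => n Nn.
    have [m nk] : exists m : nat, n%:Z + k = m%:Z.
      exists (absz (n%:Z + k)); rewrite gez0_abs//; move: Nn; lia.
    have Nm : (N <= m)%N by move: Nn nk; lia.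
    have En : (fun t => e n t * expo k t) = e m.
      by apply/funext => t; rewrite /e -expoD nk.
    rewrite En; split; first exact: H2_expo.
    apply: le_trans (hN m Nm).
    rewrite -(sqnorm2_expoM k (fun t => phi m t - f t)) le_eqVlt; apply/orP; left; apply/eqP.
    congr sqnorm2; apply/funext => t; rewrite mulrBr /phi mulrA -expoD.
    by rewrite -nk opprD addrCA subrr addr0 [f t * _]mulrC.
  - have d4 : 0 < d / 4 by rewrite divr_gt0.
    have [N1 hN1] := IH1 _ d4; have [N2 hN2] := IH2 _ d4.
    exists (maxn N1 N2) => n; rewrite geq_max => /andP[/hN1[H1 B1] /hN2[H2' B2]].
    have E12 : (fun t => e n t * (p1 t + p2 t)) = fun t => e n t * p1 t + e n t * p2 t.
      by apply/funext => t; rewrite mulrDr.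
    have H12 : H2 (fun t => e n t * (p1 t + p2 t)) by rewrite E12; exact: H2D.
    split=> //; set v1 := (X in sqnorm2 X <= _) in B1; set v2 := (X in sqnorm2 X <= _) in B2.
    have L1 : L2 v1 by apply: L2B; [exact: L2v|exact: L2fp].
    have L2' : L2 v2 by apply: L2B; [exact: L2v|exact: L2fp].
    rewrite (@sqnorm2_ae R _ (fun t => v1 t + v2 t)).
    + by apply: le_trans (sqnorm2D_le L1 L2') _; lra.
    + by apply: L2B; [exact: L2v|apply: L2fp; exact: trigpolyD].
    + exact: L2D.
    + rewrite E12; apply: ae_T_imp (opD hA H1 H2') => t _ ->.
      by rewrite /v1 /v2; ring.
  - have d' : 0 < d / (sqmod c + 1) by rewrite divr_gt0// ltr_wpDl ?sqmod_ge0.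
    have [N hN] := IH1 _ d'; exists N => n /hN[H1 B1].
    have Ec : (fun t => e n t * (c * p1 t)) = fun t => c * (e n t * p1 t).
      by apply/funext => t; rewrite mulrCA.
    have Hc : H2 (fun t => e n t * (c * p1 t)) by rewrite Ec; exact: H2Z.
    split=> //; set v1 := (X in sqnorm2 X <= _) in B1.
    have L1 : L2 v1 by apply: L2B; [exact: L2v|exact: L2fp].
    rewrite (@sqnorm2_ae R _ (fun t => c * v1 t)).
    + rewrite sqnorm2Z//; move: B1; rewrite ler_pdivlMr ?ltr_wpDl ?sqmod_ge0//.
      have := sqnorm2_ge0 v1; have := sqmod_ge0 c; nra.
    + by apply: L2B; [exact: L2v|apply: L2fp; exact: trigpolyZ].
    + exact: L2Z.
    + rewrite Ec; apply: ae_T_imp (opZ hA c H1) => t _ ->.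
      by rewrite /v1; ring.
have f_bound p : trigpoly p -> sqnorm2 (fun t => f t * p t) <= M0 * sqnorm2 p.
  move=> hp; have [N hN] := good_trigpoly p hp 1 ltr01.
  (* The sequence starts at [N] so that each z^(N+n) p lies in H^2, where the bound on [A] is
     available. *)
  apply: (@L2lim_sqnorm2_le R
    (fun n t => expo (- (N + n)%N%:Z) t * A (fun t => e (N + n) t * p t) t)).
  - by move=> n; apply: L2v; apply: (hN (N + n)%N (leq_addr _ _)).1.
  - exact: L2fp.
  - move=> d d0; have [N' hN'] := good_trigpoly p hp d d0; exists N' => n Nn.
    exact: (hN' (N + n)%N (leq_trans Nn (leq_addl _ _))).2.
  - exists 0%N => n _; rewrite sqnorm2_expoM.
    apply: le_trans (hM0 _ (hN (N + n)%N (leq_addr _ _)).1) _.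
    by rewrite sqnorm2_expoM.
have iM : mu.-integrable D (EFin \o (fun t => M0 - sqmod (f t))).
  apply: integrable_B; last exact: L2_integrable.
  have := integrable_Zl M0 (L2_integrable (@L2_cst R 1)).
  congr (mu.-integrable _ _); apply/funext => t /=.
  by rewrite /sqmod/= expr0n addr0 expr1n mulr1.
have fM : ae_T (fun t => 0 <= M0 - sqmod (f t)).
  apply: ae_ge0_of_trigpoly => // p hp.
  have i1 := L2_integrable (L2_trigpoly hp).
  have i2 := L2_integrable (L2fp p hp).
  rewrite [leRHS](_ : _ = M0 * sqnorm2 p - sqnorm2 (fun t => f t * p t)).
    by rewrite subr_ge0 f_bound.
  rewrite !sqnorm2E -(RintegralZl _ (@measurable_Tpar R) i1).
  rewrite -(RintegralB (@measurable_Tpar R) (integrable_Zl _ i1) i2).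
  by apply: eq_Rintegral => t _; rewrite sqmodM mulrBl.
exists f; split.
  split; first by case: Lf.
  by exists M0; apply: ae_T_imp fM => t _; rewrite subr_ge0.
move=> i j.
have -> : inner (fun t => f t * e i t) (e j) = inner f (expo (j%:Z - i%:Z)).
  apply: eq_cintegral => t _; rewrite addrC expoD expoN cconjM cconjK mulrA.
  by [].
apply: (L2lim_inner _ Lf (L2_expo _ _) phif) => //.
(* From n = i on, the coefficient of phi_n at j - i already equals the matrix entry, by the Toeplitz
   relation shifted by n - i. *)
exists i => n ni.
rewrite -(inner_expoM n%:Z) -(A_toeplitzD (n - i)) subnK// -inner_phi.
apply: eq_cintegral => t _; congr (_ * _^*); rewrite -expoD; congr expo.
by rewrite PoszD -subzn//; ring.
Qed.

(** The functions h for which f h and A h have the same nonnegative coefficients form a closed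
    subspace containing every z^n. Hence A g is a projection of f g onto H^2, and projections are
    unique almost everywhere. *)
Lemma brown_halmos : exists f, Linf f /\ forall g, H2 g -> ae_eqT (A g) (Toeplitz f g).
Proof.
have [f [Lf fA]] := toeplitz_symbol; exists f; split=> // g Hg.
have Lfg h : H2 h -> L2 (fun t => f t * h t) by move=> /H2_L2; exact: L2_Linf.
have LA h : H2 h -> L2 (A h) by move=> /(op_H2 hA)/H2_L2.
pose S h := H2 h /\ forall j : nat, inner (fun t => f t * h t) (e j) = inner (A h) (e j).
have Le j : L2 (e j) by exact: L2_expo.
have Slin (c : R[i]) h1 h2 : S h1 -> S h2 -> S (fun t => h1 t + c * h2 t).
  move=> [H1 e1] [H2' e2]; have H12 := H2_lin c H1 H2'; split=> // j.
  rewrite (inner_ae (LA _ H12) _ (Le j) (Le j) (op_lin hA c H1 H2')).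
  - rewrite innerDl ?innerZl//; try exact: LA; last exact/L2Z/LA.
    rewrite -e1 -e2 -innerZl//; last exact: Lfg.
    rewrite -innerDl//; [|exact: Lfg|exact/L2Z/Lfg].
    by congr inner; apply/funext => t; ring.
  - by apply: L2D; [exact: LA|exact/L2Z/LA].
  - exact: ae_T_all.
have Slim u h : (forall n : nat, S (u n)) -> H2 h -> L2lim u h -> S h.
  move=> Su Hh uh; split=> // j.
  have Hu n : H2 (u n) by case: (Su n).
  have fuh : L2lim (fun n t => f t * u n t - A (u n) t) (fun t => f t * h t - A h t).
    apply: L2limB (op_lim hA Hu Hh uh).
    - by move=> n; exact: Lfg.
    - by move=> n; exact: LA.
    - exact: Lfg.
    - exact: LA.
    - by apply: L2lim_Linf => //; [move=> n; exact: H2_L2|exact: H2_L2].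
  apply/eqP; rewrite -subr_eq0 -innerBl//; [|exact: Lfg|exact: LA].
  apply/eqP; apply: (L2lim_inner _ _ (Le j) fuh).
  + by move=> n; apply: L2B; [exact: Lfg|exact: LA].
  + by apply: L2B; [exact: Lfg|exact: LA].
  + exists 0%N => n _; rewrite innerBl//; [|exact: Lfg|exact: LA].
    by rewrite (Su n).2 subrr.
have [h [Hh fh] gh] : exists2 h, S h & ae_eqT g h.
  apply: (H2_closed_subspace _ _ Slin Slim) => //.
  - by move=> h [].
  - by move=> n; split; [exact: H2_expo|exact: fA].
have Lgd := L2B (Lfg g Hg) (LA g Hg).
have pA : is_proj (@H2 R) (fun t => f t * g t) (A g).
  split; first exact: op_H2.
  apply: orthogonal_H2 => // j.
  have Lhd := L2B (Lfg h Hh) (LA h Hh).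
  rewrite (inner_ae Lgd Lhd (Le j) (Le j)).
  - by rewrite innerBl//; [rewrite fh subrr|exact: Lfg|exact: LA].
  - by apply: ae_T_imp (ae_T_and gh (op_ae hA Hg Hh gh)) => t _ [-> ->].
  - exact: ae_T_all.
have pT := hproj_is_proj (H2_proj (Lfg g Hg)).
exact: (is_proj_unique (@H2_L2 R) (@H2B R) (Lfg g Hg) pA pT).
Qed.

End BrownHalmos.

(** * Model spaces *)

Section ModelSpace.
Variable R : realType.
Implicit Types (f g h a : R -> R[i]).

Lemma sqmod_zeta t : sqmod (zeta t) = 1 :> R.
Proof. exact: sqmod_expo. Qed.

Lemma L2_Cconj a f : Linf a -> L2 f -> L2 (Cconj a f).
Proof.
move=> La Lf; apply: L2_Linf => //; apply: L2_conj.
by apply: L2_Linf => //; exact: Linf_expo.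
Qed.

(** Both sides are the integral of a^* z f g, which is symmetric in [f] and [g]. *)
Lemma inner_Cconj_swap a f g : inner f (Cconj a g) = inner g (Cconj a f).
Proof. by apply: eq_cintegral => t _; rewrite /Cconj !cconjM !cconjK; ring. Qed.

(** The test functions that present [Kmodel a] as an annihilator, so that [annihilator_proj]
    provides P_a. *)
Definition model_orth a f := neg_expo f \/ exists2 h, H2 h & f = fun t => a t * h t.

Lemma L2_model_orth a : Linf a -> forall f, model_orth a f -> L2 f.
Proof.
by move=> La f [/L2_neg_expo//|[h /H2_L2 Lh ->]]; exact: L2_Linf.
Qed.

Lemma Kmodel_annihilator a : @Kmodel R a = annihilator (model_orth a).
Proof.
apply/funext => f; apply/propext; split.
- move=> [[Lf hf] fa]; split=> // _ [[n n0 ->]|[h Hh ->]]; first exact: hf.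
  exact: fa.
- move=> [Lf h]; split; first split=> //.
  + by move=> n n0; apply: h; left; exists n.
  + by move=> g Hg; apply: h; right; exists g.
Qed.

Lemma Kmodel_L2 a f : Kmodel a f -> L2 f.
Proof. by case=> [[]]. Qed.

Lemma Pmodel_is_proj a h : Linf a -> L2 h -> is_proj (Kmodel a) h (Pmodel a h).
Proof.
move=> La Lh; apply: hproj_is_proj; rewrite Kmodel_annihilator.
by apply: annihilator_proj => //; exact: L2_model_orth.
Qed.

Lemma inner_is_proj (S : (R -> R[i]) -> Prop) h g f : (forall f, S f -> L2 f) ->
  L2 h -> is_proj S h g -> S f -> inner g f = inner h f.
Proof.
move=> SL Lh [Sg hg] Sf; have := hg f Sf; rewrite innerBl//; try exact: SL.
by move/eqP; rewrite subr_eq0 => /eqP.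
Qed.

(** Conjugation exchanges the two defining conditions. The coefficient of C f at -(n+1) is the
    conjugate of <f, a z^n>, and |a| = 1 gives <C f, a h> = <(z h)^*, f>, where (z h)^* has only
    negative frequencies. *)
Lemma Kmodel_Cconj a f : inner_fun a -> Kmodel a f -> Kmodel a (Cconj a f).
Proof.
move=> [Ha [La a1]] [Hf fa].
have Lf := H2_L2 Hf; have LC := L2_Cconj La Lf.
split; first split => //.
- case=> // n _.
  have -> : inner (Cconj a f) (expo (- n.+1%:Z)) = (inner f (fun t => a t * expo n%:Z t))^*.
    rewrite -innerC; [|exact: Lf|by apply: L2_Linf => //; exact: L2_expo].
    apply: eq_cintegral => t _.
    rewrite /Cconj expoN cconjK intS expoD cconjM.
    transitivity ((zeta t * (zeta t)^*) * (a t * expo n%:Z t * (f t)^*)).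
      by rewrite /zeta; ring.
    by rewrite mulconj sqmod_zeta mul1r.
  by rewrite fa ?conjC0//; exact: H2_expo.
- move=> h Hh; have Lh := H2_L2 Hh.
  have Lzh : L2 (fun t => (expo 1 t * h t)^*) by apply/L2_conj/L2M_expo.
  have -> : inner (Cconj a f) (fun t => a t * h t) = inner (fun t => (expo 1 t * h t)^*) f.
    apply: cintegral_ae.
    + apply: cmeasurableM; first by case: LC.
      by apply: cmeasurable_conj; apply: cmeasurableM; [case: La|case: Lh].
    + by apply: cmeasurableM; [case: Lzh|apply: cmeasurable_conj; case: Lf].
    + apply: ae_T_imp a1 => t _ e1; rewrite /Cconj !cconjM -/(zeta t).
      transitivity ((a t * (a t)^*) * ((expo 1 t)^* * (h t)^* * (f t)^*)).
        by rewrite /zeta; ring.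
      by rewrite mulconj e1 mul1r.
  apply: orthogonal_H2 => // n.
  have -> : inner (fun t => (expo 1 t * h t)^*) (expo n%:Z) = (inner h (expo (- n.+1%:Z)))^*.
    rewrite -innerC//; last exact: L2_expo.
    apply: eq_cintegral => t _; rewrite expoN intS expoD !cconjM; ring.
  by rewrite Hh.2 ?conjC0.
Qed.

Section Compression.
Variable A : (R -> R[i]) -> (R -> R[i]).
Hypothesis hA : bounded_linear_H2 A.

(** Against a function of the model space both P_a and P disappear, leaving <phi f, g>. The symmetry
    is then a pointwise identity using |a| = |z| = 1. *)
Lemma toeplitz_complex_symmetric (phi : R -> R[i]) a : Linf phi ->
  (forall f, H2 f -> ae_eqT (A f) (Toeplitz phi f)) -> inner_fun a ->
  is_adjoint_on (Kmodel a) (compress a A)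
    (fun f => Cconj a (compress a A (Cconj a f))).
Proof.
move=> Lphi Aphi ia; have [Ha [La a1]] := ia.
have LA f : Kmodel a f -> L2 (A f) by move=> [/(op_H2 hA)/H2_L2].
have pA f : Kmodel a f -> is_proj (Kmodel a) (A f) (compress a A f).
  by move=> Kf; apply: Pmodel_is_proj => //; exact: LA.
have Afg f g : Kmodel a f -> Kmodel a g ->
    inner (compress a A f) g = inner (fun t => phi t * f t) g.
  move=> Kf Kg; have [Hf _] := Kf; have [Hg _] := Kg.
  have Lpf : L2 (fun t => phi t * f t) by apply: L2_Linf => //; exact: H2_L2.
  have pT : is_proj (@H2 R) (fun t => phi t * f t) (Toeplitz phi f).
    by apply: hproj_is_proj; exact: H2_proj.
  rewrite (inner_is_proj (@Kmodel_L2 a) (LA f Kf) (pA f Kf) Kg).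
  rewrite -(inner_is_proj (@H2_L2 R) Lpf pT Hg).
  apply: inner_ae; [exact: LA|exact/H2_L2/pT.1|exact: H2_L2|exact: H2_L2| |exact: ae_T_all].
  exact: Aphi.
split.
  move=> g Kg; apply: Kmodel_Cconj => //.
  by apply: (pA _ _).1; exact: Kmodel_Cconj.
move=> f g Kf Kg.
have KCf := Kmodel_Cconj ia Kf; have KCg := Kmodel_Cconj ia Kg.
(* The swap turns <f, C A_a C g> into <A_a C g, C f>. *)
rewrite inner_Cconj_swap !Afg//.
have [mf _] := Kmodel_L2 Kf; have [mg _] := Kmodel_L2 Kg; have [mphi _] := Lphi.
have [mCf _] := Kmodel_L2 KCf; have [mCg _] := Kmodel_L2 KCg.
apply: cintegral_ae.
- by apply: cmeasurableM; [exact: cmeasurableM|exact: cmeasurable_conj].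
- by apply: cmeasurableM; [exact: cmeasurableM|exact: cmeasurable_conj].
- apply: ae_T_imp a1 => t _ e1; rewrite /Cconj !cconjM !cconjK.
  transitivity ((a t * (a t)^*) * (zeta t * (zeta t)^*) * (phi t * f t * (g t)^*)).
    by rewrite !mulconj e1 sqmod_zeta !mul1r.
  by ring.
Qed.

(* Without an orthogonal projection of [h], [hproj S h] is [h] itself. *)
Lemma inner_hproj (S : (R -> R[i]) -> Prop) h f : (forall f, S f -> L2 f) ->
  L2 h -> S f -> inner (hproj S h) f = inner h f.
Proof.
move=> SL Lh Sf; have [ex|nex] := pselect (exists g, is_proj S h g).
  exact: inner_is_proj (hproj_is_proj ex) Sf.
by rewrite /hproj; case: pselect.
Qed.

Lemma zeta_exp n : (fun t => zeta t ^+ n) = @expo R n%:Z.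
Proof. by apply/funext => t; exact: expoXn. Qed.

Lemma inner_fun_expo (n : nat) : inner_fun (@expo R n%:Z).
Proof.
split; [exact: H2_expo|split; first exact: Linf_expo].
by apply: ae_T_all => t _; exact: sqmod_expo.
Qed.

(** For n > 0 the n-th Fourier coefficient of a constant is 0, while that of z^n is 1. *)
Lemma nonconstant_expo (n : nat) : (0 < n)%N -> nonconstant (@expo R n%:Z).
Proof.
move=> n0 [c nc].
have L k : L2 (@expo R k) by exact: L2_expo.
have Lc : L2 (fun=> c) by exact: L2_cst.
have E k : inner (expo n%:Z) (expo k) = inner (fun=> c) (expo k).
  by apply: inner_ae => //; exact: ae_T_all.
have Ec k : inner (fun=> c) (@expo R k) = c * inner (expo 0) (expo k).
  by rewrite -innerZl//; congr inner; apply/funext => t; rewrite expo0 mulr1.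
have := E n%:Z; rewrite Ec !inner_expo eqxx.
have -> : (0 == n%:Z) = false by case: n n0 {nc E}.
by rewrite mulr0 => /eqP; rewrite oner_eq0.
Qed.

(** Moving z^n across the inner product leaves the frequency i - n < 0, which is orthogonal to
    H^2. *)
Lemma Kmodel_expo (n i : nat) : (i < n)%N -> Kmodel (@expo R n%:Z) (expo i%:Z).
Proof.
move=> ni; split; first exact: H2_expo.
move=> h Hh; have Lh := H2_L2 Hh.
rewrite (innerC (L2M_expo n%:Z Lh) (L2_expo _ _)) inner_expo_shift.
have -> : (fun t => expo (- n%:Z) t * expo i%:Z t) = @expo R (- (n - i)%N%:Z).
  apply/funext => t; rewrite -expoD; congr expo; rewrite -subzn ?(ltnW ni)//; ring.
by rewrite Hh.2 ?subn_gt0// conjC0.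
Qed.

Lemma Cconj_expo (n i j : nat) : (i + j).+1 = n ->
  Cconj (expo n%:Z) (expo i%:Z) = @expo R j%:Z.
Proof.
move=> <-; apply/funext => t; rewrite /Cconj /zeta -expoD -expoN -expoD.
by congr expo; rewrite intS PoszD; ring.
Qed.

Lemma complex_symmetric_toeplitz :
  (forall n : nat, (0 < n)%N ->
    is_adjoint_on (Kmodel (@expo R n%:Z)) (compress (expo n%:Z) A)
      (fun f => Cconj (expo n%:Z) (compress (expo n%:Z) A (Cconj (expo n%:Z) f)))) ->
  forall i j : nat,
    inner (A (expo i.+1%:Z)) (expo j.+1%:Z) = inner (A (expo i%:Z)) (expo j%:Z).
Proof.
move=> sym i j; pose n := (i + j).+2.
have [_ adj] := sym n isT.
have Ki : Kmodel (@expo R n%:Z) (expo i%:Z) by apply: Kmodel_expo; lia.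
have Kj : Kmodel (@expo R n%:Z) (expo j%:Z) by apply: Kmodel_expo; lia.
have Kj1 : Kmodel (@expo R n%:Z) (expo j.+1%:Z) by apply: Kmodel_expo; lia.
have LA (k : nat) : L2 (A (expo k%:Z)) by apply: H2_L2; apply: op_H2 => //; exact: H2_expo.
have := adj _ _ Ki Kj; rewrite inner_Cconj_swap.
rewrite (@Cconj_expo n i j.+1); last by rewrite /n; lia.
rewrite (@Cconj_expo n j i.+1); last by rewrite /n; lia.
by rewrite !inner_hproj//; exact: Kmodel_L2.
Qed.

End Compression.
End ModelSpace.

Theorem theorem2p2 (R : realType) (A : (R -> R[i]) -> (R -> R[i])) :
  bounded_linear_H2 A ->
  ((exists phi : R -> R[i], Linf phi /\
       forall f, H2 f -> ae_eqT (A f) (Toeplitz phi f)) <->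
   (forall a : R -> R[i], inner_fun a -> nonconstant a ->
       is_adjoint_on (Kmodel a) (compress a A)
         (fun f => Cconj a (compress a A (Cconj a f))))) /\
  ((forall a : R -> R[i], inner_fun a -> nonconstant a ->
       is_adjoint_on (Kmodel a) (compress a A)
         (fun f => Cconj a (compress a A (Cconj a f)))) <->
   (forall n : nat, (0 < n)%N ->
       let a := fun t => (zeta t) ^+ n in
       is_adjoint_on (Kmodel a) (compress a A)
         (fun f => Cconj a (compress a A (Cconj a f))))).
Proof.
move=> hA.
set P1 := exists phi, _; set P2 := forall a, _; set P3 := forall n, _.
have H12 : P1 -> P2.
  by move=> [phi [Lphi Aphi]] a ia _; exact: toeplitz_complex_symmetric Aphi ia.
have H23 : P2 -> P3.
  move=> h n n0; rewrite /= zeta_exp.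
  by apply: h; [exact: inner_fun_expo|exact: nonconstant_expo].
have H31 : P3 -> P1.
  move=> h; apply: brown_halmos => //; apply: complex_symmetric_toeplitz => // n n0.
  by have := h n n0; rewrite /= zeta_exp.
by split; split=> // h; [exact/H31/H23|exact/H12/H31].
Qed.
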